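(* Let $n\ge1$ and let $\lambda$ be a (dominant) weight of the double cover of $GL_{2n}$, i.e. a nonincreasing vector $\lambda\in(\tfrac12\mathbb Z)^{2n}$ such that $\lambda_i-\lambda_j\in\mathbb Z$ for all $i,j$. Then $$\int P^{(2n)}_\lambda(t^{\pm1/2}z_1,\dots,t^{\pm1/2}z_n;q,t)\prod_{1\le i<j\le n}\frac{((z_i/z_j)^{\pm1};q)}{(t^2(z_i/z_j)^{\pm1};q)}\,dT=0$$ unless $\lambda_i=-\lambda_{2n+1-i}$ for all $1\le i\le 2n$.
   Context: Notation. $(a;q)=\prod_{k\ge0}(1-aq^k)$; $((z_i/z_j)^{\pm1};q)=(z_i/z_j;q)(z_j/z_i;q)$, and similarly with a scalar prefactor. The parameters $q,t$ are generic (analytically, complex with $|q|,|t|<1$). $dT$ is Haar measure on the unit torus $|z_1|=\dots=|z_n|=1$. For such $\lambda$, $P_\lambda^{(2n)}(x_1,\dots,x_{2n};q,t)=(x_1\cdots x_{2n})^{\lambda_{2n}}P^{(2n)}_{(\lambda_1-\lambda_{2n},\dots,\lambda_{2n}-\lambda_{2n})}(x_1,\dots,x_{2n};q,t)$, where on the right is the usual monic symmetric Macdonald polynomial of type $A$. The arguments $t^{\pm1/2}z_1,\dots,t^{\pm1/2}z_n$ are the $2n$ values $t^{1/2}z_1,t^{-1/2}z_1,\dots,t^{1/2}z_n,t^{-1/2}z_n$; at these arguments $(x_1\cdots x_{2n})^{1/2}$ is taken to be $z_1\cdots z_n$. *)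

(* Defs.v *)
From HB Require Import structures.
From mathcomp Require Import all_boot all_order all_algebra.
From mathcomp Require Import complex.
From mathcomp Require Import classical_sets reals topology normedtype sequences.
From mathcomp Require Import trigo measure lebesgue_measure lebesgue_integral.
(* without notations: they clash with those of the analysis library *)
From mathcomp Require Import -(notations) mpoly.

Set Implicit Arguments.
Unset Strict Implicit.
Unset Printing Implicit Defensive.

Import Order.TTheory GRing.Theory Num.Theory numFieldNormedType.Exports.

Local Open Scope ring_scope.

Definition is_partition (N : nat) (m : multinom N) : Prop :=
  forall i j : 'I_N, (i <= j)%N -> (m j <= m i)%N.

Definition dominance_le (N : nat) (m1 m2 : multinom N) : Prop :=
  mdeg m1 = mdeg m2 /\
  forall k : nat,
    (\sum_(i < N | (i < k)%N) m1 i <= \sum_(i < N | (i < k)%N) m2 i)%N.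

(* Macdonald's commuting q-difference operators
     D_N^r = t^(r(r-1)/2) sum_(|I| = r)
               prod_(i in I, j notin I) (t x_i - x_j) / (x_i - x_j)
               prod_(i in I) T_(q, x_i),
   where T_(q, x_i) replaces x_i by q x_i; meaningful at points x with
   pairwise distinct coordinates. *)
Definition macdonald_op (F : fieldType) (N : nat) (q t : F) (r : nat)
    (f : ('I_N -> F) -> F) (x : 'I_N -> F) : F :=
  t ^+ 'C(r, 2) *
  \sum_(I : {set 'I_N} | #|I| == r)
    (\prod_(i in I) \prod_(j | j \notin I) ((t * x i - x j) / (x i - x j))) *
    f (fun i => if i \in I then q * x i else x i).

(* P is the monic symmetric Macdonald polynomial P_mu(x_1, ..., x_N; q, t):
   it is m_mu plus a combination of the m_nu with nu < mu in dominance order,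
   and D_N^r P = e_r(q^(mu_1) t^(N-1), ..., q^(mu_N) t^0) P for all r.  These
   conditions determine P when q and t satisfy no relation q^a t^b = 1.  The
   eigenvalue equations are identities between rational functions, tested at
   all points with pairwise distinct coordinates. *)
Definition is_macdonald (F : fieldType) (N : nat) (q t : F)
    (mu : multinom N) (P : mpoly N F) : Prop :=
  [/\ P \is symmetric,
      mcoeff mu P = 1,
      (forall nu, nu \in msupp P -> is_partition nu ->
         dominance_le nu mu)
    & forall (r : nat) (x : 'I_N -> F), injective x ->
        macdonald_op q t r (fun y => meval y P) x =
        meval (fun i : 'I_N => q ^+ (mu i) * t ^+ (N.-1 - i))
          (mesym N F r) * meval x P].

Definition is_weight (N : nat) (lam : N.-tuple rat) : Prop :=
  [/\ forall i, 2 * tnth lam i \is a Num.int,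
      forall i j, tnth lam i - tnth lam j \is a Num.int
    & forall i j : 'I_N, (i <= j)%N -> tnth lam j <= tnth lam i].

(* The partition (lam_1 - lam_N, ..., lam_N - lam_N); [last 0 lam] is lam_N
   and, for a weight, the truncation is exact. *)
Definition weight_partition (N : nat) (lam : N.-tuple rat) :
    multinom N :=
  Multinom [tuple Num.truncn (tnth lam i - last 0 lam) | i < N].

(* The value at x of (x_1 ... x_N)^(lam_N) P(x), where y is the chosen value
   of (x_1 ... x_N)^(1/2); for a weight, 2 lam_N is an integer and the floor
   is exact. *)
Definition weight_eval (F : fieldType) (N : nat) (lam : N.-tuple rat)
    (P : mpoly N F) (x : 'I_N -> F) (y : F) : F :=
  y ^ Num.floor (2 * last 0 lam) * meval x P.

(* The arguments s z_1, s^-1 z_1, ..., s z_n, s^-1 z_n. *)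
Definition doubled_args (F : fieldType) (n : nat) (s : F) (z : n.-tuple F)
    (i : 'I_(2 * n)) : F :=
  (if odd i then s^-1 else s) * z`_(i./2).

Section Torus.
Variable R : realType.
Local Notation C := R[i].

Definition generic (q t : C) : Prop :=
  [/\ 0 < `|q| < 1, 0 < `|t| < 1
    & forall a b : int, q ^ a * t ^ b = 1 -> a = 0 /\ b = 0].

(* (a; q); the limit is taken in C^o, i.e. C with its norm topology. *)
Definition qpoch (a q : C) : C :=
  limn (fun m : nat => \prod_(k < m) (1 - a * q ^+ k) : C^o).

(* (c u^(+-1); q) = (c u; q) (c u^-1; q) *)
Definition qpoch_pm (c u q : C) : C := qpoch (c * u) q * qpoch (c * u^-1) q.

Definition expi (theta : R) : C :=
  (cos (2 * pi * theta) +i* sin (2 * pi * theta))%C.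

Definition circle_mean (f : C -> C) : C :=
  (Rintegral lebesgue_measure `[0, 1]%classic
    (fun theta => complex.Re (f (expi theta)))
  +i*
  Rintegral lebesgue_measure `[0, 1]%classic
    (fun theta => complex.Im (f (expi theta))))%C.

(* Integration against the normalized Haar measure of the torus, written as an
   iterated integral. *)
Fixpoint torus_integral (n : nat) : (n.-tuple C -> C) -> C :=
  match n with
  | 0 => fun f => f [tuple]
  | m.+1 => fun f =>
      circle_mean (fun w => torus_integral (fun z => f (cons_tuple w z)))
  end.

Definition torus_density (n : nat) (q t : C) (z : n.-tuple C) : C :=
  \prod_(i < n) \prod_(j < n | (i < j)%N)
    (qpoch_pm 1 (tnth z i / tnth z j) q /
     qpoch_pm (t ^+ 2) (tnth z i / tnth z j) q).

End Torus.

(* Main.v *)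
(** Let L(f) be the integral of f(s z_1, s^-1 z_1, ..., s z_n, s^-1 z_n) against
   the density, where s^2 = t.  At such a point the coefficient of D_N^r vanishes
   for every index set containing s^-1 z_k but not s z_k, so D_N^r shifts each z_k
   completely (k in B), by half (k in A) or not at all.  Replacing z_k by q^-1 z_k
   for k in B crosses no pole, and the sum over the B of a given size b becomes
   symmetric under b -> n - |A| - b by an identity of Ruijsenaars.  Hence L(D_N^r P)
   and L(D_N^(N-r) P) are proportional, with an explicit factor.  If L(P) is not
   zero, the eigenvalues satisfy e_(N-r)(X) = K rho^r e_r(X) for all r, where
   X_i = q^(mu_i) t^(N-i): the spectrum X is stable under x -> 1 / (rho x), and
   genericity of q, t turns this into lam_i = - lam_(N+1-i). *)
Require Import Defs.
From mathcomp Require Import all_boot all_order all_algebra.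
From mathcomp Require Import ring lra zify.
From mathcomp Require boolp classical_sets functions constructive_ereal ereal.
From mathcomp Require topology normedtype sequences derive realfun exp.
From mathcomp Require trigo measure lebesgue_measure lebesgue_integral ftc.
From mathcomp Require Import complex reals.
From mathcomp Require Import -(notations) mpoly.

Set Implicit Arguments.
Unset Strict Implicit.
Unset Printing Implicit Defensive.

Import Order.TTheory GRing.Theory Num.Theory.
Import ComplexField.Normc.
Local Open Scope ring_scope.

(** * Ruijsenaars' identity *)

(** The substitution z_k -> q^-1 z_k for k in B undoes the full shifts, so the value of P depends on
    A alone and leaves the sum over B. Of the rest, only pairs joining B to the complement N of A
    and B depend on B: each gives t^2 times Ruijsenaars' factor with parameters t^2 and q/t, and
    (t^2)^(|B| |N|) is itself symmetric under b -> n - |A| - b. The explicit factor comes from the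
    monomial (z_1 ... z_n)^m, m = 2 lam_(2n), which yields q^(-m) per substituted variable, and from
    the powers t^(r(r-1)/2): rho = q^m / t^(2n-1) and K = q^(-mn) t^(n(2n-1)). Two obstacles shape
    the proof. The eigenvalue equations hold at distinct coordinates only, and their coefficients
    have poles at z_k = z_l; the zeros of the density deal with both. Moving the contour is replaced
    by uniform approximation: integrands are limits of Laurent polynomials, whose integral is the
    constant term, and it suffices to expand each denominator in a product or geometric series that
    converges on the old and the new torus. *)

Lemma coefM_top (F : nzRingType) (p q : {poly F}) (a b : nat) :
  (size p <= a.+1)%N -> (size q <= b.+1)%N -> (p * q)`_(a + b) = p`_a * q`_b.
Proof.
move=> sp sq; rewrite coefM (bigD1 (inord a)) //= inordK ?ltnS ?leq_addr //.
rewrite addKn big1 ?addr0 // => i; rewrite -val_eqE /= inordK ?ltnS ?leq_addr //.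
move=> ia; case: (ltngtP i a) ia => // ia _.
  rewrite [q`__]nth_default ?mulr0 //; apply: leq_trans sq _.
  by rewrite ltn_subRL ltn_add2r.
by rewrite nth_default ?mul0r //; apply: leq_trans sp _.
Qed.

Lemma size_coef_prod (F : idomainType) (J : eqType) (r : seq J)
    (p : J -> {poly F}) (d : nat) (c : F) :
  {in r, forall j, (size (p j) <= d.+1)%N /\ (p j)`_d = c} ->
  (size (\prod_(j <- r) p j)%R <= (d * size r).+1)%N /\
  (\prod_(j <- r) p j)`_(d * size r) = c ^+ size r.
Proof.
elim: r => [|j r IH] H; first by rewrite big_nil muln0 coef1 size_poly1 expr0.
have [sj cj] := H j (mem_head _ _).
have [sr cr] : (size (\prod_(j <- r) p j)%R <= (d * size r).+1)%N /\
  (\prod_(j <- r) p j)`_(d * size r) = c ^+ size r.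
  by apply: IH => k kr; apply: H; rewrite inE kr orbT.
rewrite big_cons /= mulnS exprS coefM_top // cj cr; split => //.
apply: leq_trans (size_polyMleq _ _) _; rewrite -subn1 leq_subLR add1n.
by apply: leq_trans (leq_add sj sr) _; rewrite addSn addnS.
Qed.

Lemma poly_eq0_roots (F : fieldType) (p : {poly F}) (d : nat) (r : seq F) :
  (size p <= d.+1)%N -> p`_d = 0 -> uniq r -> size r = d ->
  {in r, forall x, p.[x] = 0} -> p = 0.
Proof.
move=> sp pd ur sr H; apply/eqP/negP => /negP p0.
have : (size r < size p)%N.
  by apply: max_poly_roots => //; apply/allP => x /H/eqP.
rewrite sr ltnNge => /negP; apply.
rewrite leqNgt; apply/negP => dp.
have sE : size p = d.+1 by apply/eqP; rewrite eqn_leq sp.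
by move: p0; rewrite -lead_coef_eq0 lead_coefE sE /= pd eqxx.
Qed.

Lemma sum_subset_setU1 (V : nmodType) (I : finType) (m : I) (M : {set I})
    (G : {set I} -> V) : m \notin M ->
  \sum_(B : {set I} | B \subset m |: M) G B =
  \sum_(B : {set I} | B \subset M) (G (m |: B) + G B).
Proof.
move=> mM; rewrite big_split /= (bigID (fun B : {set I} => m \in B)) /=; congr (_ + _).
  rewrite (reindex_onto (fun B : {set I} => m |: B) (fun B => B :\ m)) /=; last first.
    by move=> B /andP[_ mB]; rewrite setD1K.
  apply: eq_bigl => B; rewrite setU11 andbT.
  apply/andP/idP => [[BM /eqP<-]|BM].
    apply/subsetP => x; rewrite !inE => /andP[/negPf xm].
    by rewrite xm /= => xB; have := subsetP BM x; rewrite !inE xm xB => /(_ isT).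
  rewrite setUS //; split=> //; rewrite setU1K //.
  by apply: contra mM => /(subsetP BM).
apply: eq_bigl => B; apply/andP/idP => [[BM mB]|BM].
  apply/subsetP => x xB; have := subsetP BM x xB; rewrite !inE => /orP[/eqP xm|//].
  by move: mB; rewrite -xm xB.
split; first by rewrite (subset_trans BM) ?subsetUr.
by apply: contra mM => /(subsetP BM).
Qed.

Section RuijsenaarsIdentity.
Variables (F : fieldType) (I : finType) (z : I -> F) (al be : F).
Hypotheses (al0 : al != 0) (be0 : be != 0).
Let ga := al * be.

(** With x/y = e^u, [al] = e^a and [be] = e^b this is s(u-a) s(u-b) / (s(u) s(u-a-b)) for s(v) =
    sinh(v/2), the factor in Ruijsenaars' functional equations. It tends to 1 when x or y tends to
    infinity. *)
Definition rphi (x y : F) : F :=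
  (x - al * y) * (x - be * y) / ((x - y) * (x - ga * y)).

Definition rweight (B N : {set I}) : F :=
  \prod_(k in B) \prod_(l in N) rphi (z k) (z l).

(** These conditions make the points [z l], [ga * z l] and [z l / ga], for l in M, pairwise
    distinct, as the root count requires. For nonempty M, the case k = l excludes ga = 1 and ga^2 =
    1. *)
Definition rgeneric (M : {set I}) : Prop :=
  [/\ {in M &, injective z}, {in M, forall k, z k != 0},
      {in M &, forall k l, z k != ga * z l}
    & {in M &, forall k l, z k != ga ^+ 2 * z l}].

Lemma rgenericS (M M' : {set I}) : M' \subset M -> rgeneric M -> rgeneric M'.
Proof.
move=> /subsetP s [h1 h2 h3 h4].
by split=> [k l /s kM /s lM|k /s kM|k l /s kM /s lM|k l /s kM /s lM]; auto.
Qed.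

(* Antisymmetric weights e let the induction treat all sizes of B at once. *)
Let rsum (M : {set I}) (e : nat -> nat -> F) : F :=
  \sum_(B : {set I} | B \subset M)
    rweight B (M :\: B) * e #|B| #|M :\: B|.

Lemma rweightUl m (B N : {set I}) : m \notin B ->
  rweight (m |: B) N = (\prod_(l in N) rphi (z m) (z l)) * rweight B N.
Proof. by move=> mB; rewrite /rweight big_setU1. Qed.

Lemma rweightUr m (B N : {set I}) : m \notin N ->
  rweight B (m |: N) = (\prod_(k in B) rphi (z k) (z m)) * rweight B N.
Proof.
move=> mN; rewrite /rweight -big_split /=.
by apply: eq_bigr => k kB; rewrite big_setU1.
Qed.

Lemma setU1D m (M B : {set I}) : m \notin M -> B \subset M ->
  ((m |: M) :\: (m |: B) = M :\: B) * ((m |: M) :\: B = m |: (M :\: B)).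
Proof.
move=> mM BM; split; apply/setP => x; rewrite !inE; case: eqP => //= xm.
- by rewrite xm (negPf mM) andbF.
- by rewrite xm andbT; apply: contra mM => /(subsetP BM).
Qed.

Lemma prod_setD (G : I -> F) (M B : {set I}) : B \subset M ->
  \prod_(j in M) G j = (\prod_(j in B) G j) * (\prod_(j in M :\: B) G j).
Proof.
move=> BM; rewrite (big_setID B) /=; congr (_ * _).
by rewrite (setIidPr BM).
Qed.

(** At x = [z m], the quotients of [p1 l] and [p2 l] by [p0 l] are [rphi x (z l)] and
    [rphi (z l) x]. All three cubics have leading coefficient - ga, so in top degree a product over
    l does not see on which side each l lies. *)
Let p0 (l : I) : {poly F} :=
  ('X - (z l)%:P) * ('X - (ga * z l)%:P) * ((z l)%:P - ga%:P * 'X).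
Let p1 (l : I) : {poly F} :=
  ('X - (al * z l)%:P) * ('X - (be * z l)%:P) * ((z l)%:P - ga%:P * 'X).
Let p2 (l : I) : {poly F} :=
  - (((z l)%:P - al%:P * 'X) * ((z l)%:P - be%:P * 'X) * ('X - (ga * z l)%:P)).

(* The sum over m |: M as a function of 'X = z m, times its denominator.  It has
   degree less than 3 #|M| and vanishes at z l, ga * z l and z l / ga for l in M:
   at z l the two choices separating m from l cancel, and at the other two points
   the residue is a multiple of the sum over M :\ l. *)
Let Q (M : {set I}) (e : nat -> nat -> F) : {poly F} :=
  \sum_(B : {set I} | B \subset M) (
   (rweight B (M :\: B) * e #|B|.+1 #|M :\: B|)%:P *
      \prod_(l in M) (if l \in B then p0 l else p1 l) +
   (rweight B (M :\: B) * e #|B| #|M :\: B|.+1)%:P *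
      \prod_(l in M) (if l \in B then p2 l else p0 l)).

Let p0E l x : (p0 l).[x] = (x - z l) * (x - ga * z l) * (z l - ga * x).
Proof. by rewrite /p0 !hornerE. Qed.
Let p1E l x : (p1 l).[x] = (x - al * z l) * (x - be * z l) * (z l - ga * x).
Proof. by rewrite /p1 !hornerE. Qed.
Let p2E l x : (p2 l).[x] = - ((z l - al * x) * (z l - be * x) * (x - ga * z l)).
Proof. by rewrite /p2 !hornerE. Qed.

Let prod_if (M B : {set I}) (f g : I -> F) : B \subset M ->
  \prod_(l in M) (if l \in B then f l else g l) =
  (\prod_(l in B) f l) * (\prod_(l in M :\: B) g l).
Proof.
move=> BM; rewrite (prod_setD _ BM); congr (_ * _).
  by apply: eq_bigr => l ->.
by apply: eq_bigr => l; rewrite !inE => /andP[/negPf->].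
Qed.

Let QE M e x : (Q M e).[x] = \sum_(B : {set I} | B \subset M)
  rweight B (M :\: B) * (
   e #|B|.+1 #|M :\: B| *
      ((\prod_(l in B) (p0 l).[x]) * \prod_(l in M :\: B) (p1 l).[x]) +
   e #|B| #|M :\: B|.+1 *
      ((\prod_(l in B) (p2 l).[x]) * \prod_(l in M :\: B) (p0 l).[x])).
Proof.
rewrite /Q horner_sum; apply: eq_bigr => B BM.
rewrite hornerD !hornerM !hornerC !horner_prod mulrDr !mulrA.
rewrite -!(mulrA (_ * e _ _)).
rewrite -(prod_if (fun l => (p0 l).[x]) (fun l => (p1 l).[x]) BM).
rewrite -(prod_if (fun l => (p2 l).[x]) (fun l => (p0 l).[x]) BM).
by congr (_ * _ + _ * _); apply: eq_bigr => l _; case: ifP.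
Qed.

Let size_p c0 c1 c2 c3 c4 c5 :
  let p := ((c0%:P + c1%:P * 'X) * (c2%:P + c3%:P * 'X) * (c4%:P + c5%:P * 'X)
              : {poly F}) in
  (size p <= 4)%N /\ p`_3 = c1 * c3 * c5.
Proof.
have s a b : (size (a%:P + b%:P * 'X : {poly F})%R <= 2)%N.
  apply: leq_trans (size_polyD _ _) _; rewrite geq_max.
  rewrite (leq_trans (size_polyC_leq1 _)) //=.
  by rewrite mul_polyC (leq_trans (size_scale_leq _ _)) ?size_polyX.
have c a b : (a%:P + b%:P * 'X : {poly F})`_1 = b.
  by rewrite coefD coefC /= add0r coefCM coefX mulr1.
have s2 a b a' b' : (size ((a%:P + b%:P * 'X) * (a'%:P + b'%:P * 'X) : {poly F})%R <= 3)%N.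
  apply: leq_trans (size_polyMleq _ _) _; rewrite -subn1 leq_subLR.
  exact: leq_add (s _ _) (s _ _).
move=> p; split.
  apply: leq_trans (size_polyMleq _ _) _; rewrite -subn1 leq_subLR.
  exact: leq_add (s2 _ _ _ _) (s _ _).
by rewrite (@coefM_top _ _ _ 2 1) // (@coefM_top _ _ _ 1 1) // !c.
Qed.

Let size_p0 l : (size (p0 l) <= 4)%N /\ (p0 l)`_3 = - ga.
Proof.
have := size_p (- z l) 1 (- (ga * z l)) 1 (z l) (- ga).
have -> : (((- z l)%:P + 1%:P * 'X) * ((- (ga * z l))%:P + 1%:P * 'X) *
   ((z l)%:P + (- ga)%:P * 'X)) = p0 l :> {poly F}.
  by rewrite /p0 !polyCN !polyCM; ring.
by case=> ? ->; split=> //; ring.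
Qed.

Let size_p1 l : (size (p1 l) <= 4)%N /\ (p1 l)`_3 = - ga.
Proof.
have := size_p (- (al * z l)) 1 (- (be * z l)) 1 (z l) (- ga).
have -> : (((- (al * z l))%:P + 1%:P * 'X) * ((- (be * z l))%:P + 1%:P * 'X) *
   ((z l)%:P + (- ga)%:P * 'X)) = p1 l :> {poly F}.
  by rewrite /p1 !polyCN !polyCM; ring.
by case=> ? ->; split=> //; ring.
Qed.

Let size_p2 l : (size (p2 l) <= 4)%N /\ (p2 l)`_3 = - ga.
Proof.
have := size_p (z l) (- al) (z l) (- be) (ga * z l) (- 1).
have -> : (((z l)%:P + (- al)%:P * 'X) * ((z l)%:P + (- be)%:P * 'X) *
   ((ga * z l)%:P + (- 1)%:P * 'X)) = p2 l :> {poly F}.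
  by rewrite /p2 !polyCN !polyCM; ring.
by case=> ? ->; split=> //; rewrite /ga; ring.
Qed.

Let size_coef_prod_if (M B : {set I}) (f g : I -> {poly F}) :
  (forall l, (size (f l) <= 4)%N /\ (f l)`_3 = - ga) ->
  (forall l, (size (g l) <= 4)%N /\ (g l)`_3 = - ga) ->
  (size (\prod_(l in M) (if l \in B then f l else g l))%R <= (3 * #|M|).+1)%N /\
  (\prod_(l in M) (if l \in B then f l else g l))`_(3 * #|M|) = (- ga) ^+ #|M|.
Proof.
move=> hf hg; rewrite -big_enum cardE; apply: size_coef_prod => j _.
by case: ifP.
Qed.

Let Q_size M e : (size (Q M e) <= (3 * #|M|).+1)%N.
Proof.
apply: leq_trans (size_sum _ _ _) _; apply/bigmax_leqP => B BM.
apply: leq_trans (size_polyD _ _) _; rewrite geq_max !mul_polyC.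
apply/andP; split; apply: leq_trans (size_scale_leq _ _) _.
- by case: (size_coef_prod_if M B size_p0 size_p1).
- by case: (size_coef_prod_if M B size_p2 size_p0).
Qed.

(** This is the limit of [z m] at infinity, where every [rphi] involving m tends to 1. The new
    weights are antisymmetric again, so the induction hypothesis makes the coefficient vanish. *)
Let Q_coef M e : (Q M e)`_(3 * #|M|) =
  (- ga) ^+ #|M| * rsum M (fun i j => e i.+1 j + e i j.+1).
Proof.
rewrite /Q coef_sum /rsum big_distrr; apply: eq_bigr => B BM /=.
rewrite coefD !coefCM.
case: (size_coef_prod_if M B size_p0 size_p1) => _ ->.
case: (size_coef_prod_if M B size_p2 size_p0) => _ ->.
ring.
Qed.

(** A term with p and m on the same side contains the factor [p0 p], which vanishes at x. In the
    others p and m lie on opposite sides, so both arguments of [e] go up by one. *)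
Let Q_split (M : {set I}) e p x : p \notin M -> (p0 p).[x] = 0 ->
  (Q (p |: M) e).[x] = \sum_(B : {set I} | B \subset M)
  rweight B (M :\: B) * e #|B|.+1 #|M :\: B|.+1 *
  ((p2 p).[x] * (\prod_(l in B) (p2 l).[x]) *
        (\prod_(l in M :\: B) (rphi (z p) (z l) * (p0 l).[x])) +
   (p1 p).[x] * (\prod_(l in B) (rphi (z l) (z p) * (p0 l).[x])) *
        (\prod_(l in M :\: B) (p1 l).[x])).
Proof.
move=> pM p00; rewrite QE sum_subset_setU1 //; apply: eq_bigr => B BM.
have pB : p \notin B by apply: contra pM => /(subsetP BM).
have pN : p \notin M :\: B by rewrite !inE (negPf pM) andbF.
rewrite !setU1D // rweightUl // rweightUr // !big_setU1 //= p00 !cardsU1 pB pN !add1n.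
rewrite !(mul0r, mulr0, add0r, addr0) !big_split /=; ring.
Qed.

Let rsum0 e : (forall i, e i i = 0) -> rsum set0 e = 0.
Proof.
move=> e0; rewrite /rsum big1 // => B; rewrite subset0 => /eqP->.
by rewrite set0D e0 mulr0.
Qed.

Lemma ruijsenaars_identity (M : {set I}) (e : nat -> nat -> F) :
  rgeneric M -> (forall i j, e i j = - e j i) -> (forall i, e i i = 0) ->
  rsum M e = 0.
Proof.
move: {2}#|M| (leqnn #|M|) => c; elim: c M e => [|c IH] M e.
  by rewrite leqn0 cards_eq0 => /eqP-> _ _; exact: rsum0.
move=> cM gM he he0.
have [->|[m mM]] := set_0Vmem M; first exact: rsum0.
pose M' := M :\ m; have mM' : m \notin M' by rewrite !inE eqxx.
have ME : M = m |: M' by rewrite setD1K.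
have M'M : M' \subset M by rewrite ME subsetUr.
have [zI z0 zg zg2] := gM.
have cM' : (#|M'| <= c)%N.
  by move: cM; rewrite ME cardsU1 mM' add1n ltnS.
have ga0 : ga != 0 by rewrite mulf_neq0.
have IHr p : p \in M' -> rsum (M' :\ p) (fun i j => e i.+1 j.+1) = 0.
  move=> pM'; apply: IH => //.
    by apply: leq_trans cM'; rewrite subset_leq_card // subD1set.
  by apply: rgenericS gM; apply: subset_trans M'M; rewrite subD1set.
have Q0 : Q M' e = 0.
  pose E := enum M'.
  apply: (@poly_eq0_roots _ _ (3 * #|M'|)
     ([seq z l | l <- E] ++ [seq ga * z l | l <- E] ++ [seq ga^-1 * z l | l <- E])) => //.
  - rewrite Q_coef IH ?mulr0 //; first exact: rgenericS gM.
      by move=> i j; rewrite (he i.+1) (he i) addrC -opprD.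
    by move=> i; rewrite he addNr.
  - have EM l : l \in E -> l \in M by rewrite mem_enum => /(subsetP M'M).
    rewrite !cat_uniq !map_inj_in_uniq ?enum_uniq /=; first last.
    + by move=> k l /EM kM /EM lM; apply: zI.
    + by move=> k l /EM kM /EM lM /(mulfI ga0); apply: zI.
    + by move=> k l /EM kM /EM lM /(mulfI (invr_neq0 ga0)); apply: zI.
    rewrite andbT; apply/andP; split; apply/hasPn => x.
      rewrite mem_cat => /orP[] /mapP[k /EM kM ->]; apply/mapP => -[l /EM lM].
        by move=> /esym; apply/eqP; rewrite zg.
      move/(congr1 (fun x => ga * x)); rewrite mulVKf //; apply/eqP; exact: zg.
    move=> /mapP[k /EM kM ->]; apply/mapP => -[l /EM lM].
    move/(congr1 (fun x => ga * x)); rewrite mulVKf // mulrA; apply/eqP; exact: zg2.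
  - by rewrite !size_cat !size_map -cardE mulSn mul2n -addnn.
  have nz p j : p \in M' -> j \in M' :\ p ->
    [&& z p - z j != 0, z j - z p != 0, z p - ga * z j != 0,
      z j - ga * z p != 0, z j != 0 & z p != 0].
    move=> /(subsetP M'M) pM /setD1P[jp /(subsetP M'M) jM].
    have ne : z p != z j by apply: contra jp => /eqP/(zI _ _ pM jM)->.
    by rewrite !subr_eq0 !zg // !z0 // ne eq_sym ne.
  have root p x : p \in M' ->
    x \in [:: z p; ga * z p; ga^-1 * z p] -> (Q M' e).[x] = 0; last first.
    move=> x; rewrite !mem_cat => /or3P[] /mapP[p]; rewrite mem_enum => pM' ->;
      by apply: (root p); rewrite // !inE eqxx ?orbT.
  move=> pM'; pose M2 := M' :\ p; have pM2 : p \notin M2 by rewrite !inE eqxx.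
  have M'E : M' = p |: M2 by rewrite setD1K.
  have {}nz j := nz p j pM'.
  rewrite !inE => /or3P[] /eqP->.
  - rewrite M'E Q_split // ?p0E ?subrr ?mul0r // big1 // => B BM.
    have -> : \prod_(l in B) (rphi (z l) (z p) * (p0 l).[z p]) =
              \prod_(l in B) (p2 l).[z p].
      apply: eq_bigr => j jB; have /nz/and5P[? ? ? ? _] := subsetP BM j jB.
      rewrite p0E p2E /rphi -/ga; field; exact/andP.
    have -> : \prod_(l in M2 :\: B) (rphi (z p) (z l) * (p0 l).[z p]) =
              \prod_(l in M2 :\: B) (p1 l).[z p].
      apply: eq_bigr => j /setDP[/nz/and5P[? ? ? ? _] _].
      rewrite p0E p1E /rphi -/ga; field; exact/andP.
    by rewrite p1E p2E /ga; ring.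
  - rewrite M'E Q_split // ?p0E ?subrr ?mulr0 ?mul0r //.
    (* At x = [ga * z p] the factor [p2 p] vanishes, and j contributes the same [h j] whether it
       lies in B or not; hence these factors leave the sum. *)
    pose h j := ga * (z j - al * z p) * (z j - be * z p) * (z j - ga ^+ 2 * z p).
    transitivity ((p1 p).[ga * z p] * (\prod_(j in M2) h j) *
      rsum M2 (fun i j => e i.+1 j.+1)); last by rewrite IHr // mulr0.
      rewrite /rsum big_distrr; apply: eq_bigr => B BM /=.
      rewrite p2E subrr mulr0 oppr0 !mul0r add0r (prod_setD h BM).
      have -> : \prod_(l in B) (rphi (z l) (z p) * (p0 l).[ga * z p]) =
                \prod_(l in B) h l.
        apply: eq_bigr => j jB; have /nz/and5P[? ? ? ? _] := subsetP BM j jB.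
        rewrite p0E /h /rphi -/ga; field; exact/andP.
      have -> : \prod_(l in M2 :\: B) (p1 l).[ga * z p] = \prod_(l in M2 :\: B) h l.
        by apply: eq_bigr => j _; rewrite p1E /h /ga; ring.
      ring.
  - rewrite M'E Q_split //; last by rewrite p0E mulrA divff // mul1r subrr mulr0.
    (* The roles are exchanged at x = [z p / ga]: now [p1 p] vanishes, and j again contributes [h j]
       on either side. *)
    pose h j := (p2 j).[ga^-1 * z p].
    transitivity ((p2 p).[ga^-1 * z p] * (\prod_(j in M2) h j) *
      rsum M2 (fun i j => e i.+1 j.+1)); last by rewrite IHr // mulr0.
      rewrite /rsum big_distrr; apply: eq_bigr => B BM /=.
      rewrite p1E mulVKf // subrr !mulr0 !mul0r addr0 (prod_setD h BM).
      have -> : \prod_(l in M2 :\: B) (rphi (z p) (z l) * (p0 l).[ga^-1 * z p]) =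
                \prod_(l in M2 :\: B) h l.
        apply: eq_bigr => j /setDP[/nz/and5P[? ? ? ? _] _].
        by rewrite p0E /h p2E /rphi /ga; field; apply/and4P.
      rewrite [\prod_(l in B) (p2 l).[_]](eq_bigr h) //; ring.
(* Back at x = [z m], where Q is the wanted sum times the common denominator D, nonzero by
   genericity. *)
have QM' := QE M' e (z m); rewrite Q0 horner0 in QM'.
pose D := \prod_(l in M') (p0 l).[z m].
have D0 : D != 0.
  rewrite prodf_seq_neq0; apply/allP => l _; apply/implyP.
  rewrite !inE => /andP[lm lM]; rewrite p0E !mulf_neq0 // subr_eq0.
  - by apply: contra lm => /eqP /zI ->.
  - exact: zg.
  - exact: zg.
have E0 : D * rsum M e = 0.
  apply/esym/(etrans QM').
  rewrite /rsum ME sum_subset_setU1 // big_distrr; apply: eq_bigr => B BM /=.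
  have mB : m \notin B by apply: contra mM' => /(subsetP BM).
  have mN : m \notin M' :\: B by rewrite !inE eqxx !andbF.
  rewrite !setU1D // rweightUl // rweightUr // !cardsU1 mB mN !add1n /D.
  rewrite !(prod_setD _ BM).
  set w := rweight _ _; set e1 := e _ _; set e2 := e _ _.
  have nzm j : j \in M' -> [&& z m - z j != 0, z j - z m != 0,
      z m - ga * z j != 0 & z j - ga * z m != 0].
    move=> /setD1P[jm jM].
    have ne : z m != z j by apply: contra jm => /eqP/(zI _ _ mM jM)->.
    by rewrite !subr_eq0 !zg // ne eq_sym ne.
  have -> : \prod_(l in M' :\: B) (p1 l).[z m] =
      \prod_(l in M' :\: B) (rphi (z m) (z l) * (p0 l).[z m]).
    apply: eq_bigr => j /setDP[/nzm/and4P[? ? ? ?] _].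
    by rewrite p0E p1E /rphi -/ga; field; apply/andP.
  have -> : \prod_(l in B) (p2 l).[z m] =
      \prod_(l in B) (rphi (z l) (z m) * (p0 l).[z m]).
    apply: eq_bigr => j jB; have /nzm/and4P[? ? ? ?] := subsetP BM j jB.
    by rewrite p0E p2E /rphi -/ga; field; apply/andP.
  by rewrite !big_split /=; ring.
by apply/eqP; move/eqP: E0; rewrite mulf_eq0 (negPf D0).
Qed.

Lemma ruijsenaars_card (M : {set I}) (b b' : nat) :
  rgeneric M -> (b + b')%N = #|M| ->
  \sum_(B : {set I} | (B \subset M) && (#|B| == b)) rweight B (M :\: B) =
  \sum_(B : {set I} | (B \subset M) && (#|B| == b')) rweight B (M :\: B).
Proof.
(* The antisymmetric weight [f i j - f j i] selects the sizes b and b' with opposite signs. *)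
move=> gM bb; pose f i j : F := ((i == b) && (j == b'))%:R.
have /eqP : rsum M (fun i j => f i j - f j i) = 0.
  by apply: ruijsenaars_identity => // [i j|i]; rewrite ?opprB ?subrr.
rewrite /rsum (eq_bigr _ (fun B _ => mulrBr _ _ _)) big_split sumrN subr_eq0 => /eqP E.
rewrite [LHS]big_mkcondr [RHS]big_mkcondr /=.
have fE (B : {set I}) c c' : B \subset M -> (c + c')%N = #|M| ->
    (#|B| == c) && (#|M :\: B| == c') = (#|B| == c).
  move=> BM cc; apply: andb_idr => /eqP Bc.
  by rewrite -(eqn_add2l #|B|) -{1}(setIidPr BM) cardsID Bc cc.
have b'b : (b' + b)%N = #|M| by rewrite addnC.
transitivity (\sum_(B : {set I} | B \subset M)
    rweight B (M :\: B) * f #|B| #|M :\: B|).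
  apply: eq_bigr => B BM; rewrite /f (fE _ _ _ BM bb).
  by case: ifP; rewrite ?mulr1 ?mulr0.
rewrite E; apply: eq_bigr => B BM; rewrite /f andbC (fE _ _ _ BM b'b).
by case: ifP; rewrite ?mulr1 ?mulr0.
Qed.
End RuijsenaarsIdentity.

(** * Macdonald operators at doubled arguments *)

Section DoubledIndices.
Variable n : nat.
Implicit Types (k l : 'I_n) (e : bool) (i j : 'I_(2 * n)).

Lemma dbl_subproof k e : (k.*2 + e < 2 * n)%N.
Proof. by case: k e => k kn [] /=; lia. Qed.
(** [e = false] is the place of [s * z k] and [e = true] that of [s^-1 * z k], following the parity
    convention of [doubled_args]. *)
Definition dbl k e : 'I_(2 * n) := Ordinal (dbl_subproof k e).

Lemma dblh_subproof i : (i./2 < n)%N.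
Proof. by case: i => i /= ni; lia. Qed.
Definition dblh i : 'I_n := Ordinal (dblh_subproof i).

Lemma dblK k e : (dblh (dbl k e) = k) * (odd (dbl k e) = e).
Proof.
split; last by rewrite /= oddD odd_double oddb.
by apply: val_inj => /=; case: e; lia.
Qed.

Lemma dblhK i : dbl (dblh i) (odd i) = i.
Proof. by apply: val_inj => /=; lia. Qed.

Lemma prod_dbl (R : comNzRingType) (f : 'I_(2 * n) -> R) :
  \prod_i f i = \prod_k (f (dbl k false) * f (dbl k true)).
Proof.
rewrite (reindex (fun p : 'I_n * bool => dbl p.1 p.2)) /=.
  rewrite -(pair_big xpredT xpredT (fun k e => f (dbl k e))) /=.
  by apply: eq_bigr => k _; rewrite big_bool mulrC.
exists (fun i => (dblh i, odd i)) => [[k e] _|i _] /=; last exact: dblhK.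
by rewrite !dblK.
Qed.

Definition dbl_set (U V : {set 'I_n}) : {set 'I_(2 * n)} :=
  [set i | dblh i \in (if odd i then V else U)].

Lemma in_dbl_set U V k e : (dbl k e \in dbl_set U V) = (k \in if e then V else U).
Proof. by rewrite inE !dblK. Qed.

Lemma card_dbl_set U V : #|dbl_set U V| = (#|U| + #|V|)%N.
Proof.
have cE (T : finType) (S : {set T}) : #|S| = (\sum_(x : T) (x \in S))%N.
  by rewrite -sum1_card big_mkcond /=; apply: eq_bigr => x _; case: (x \in S).
rewrite !cE -big_split /= (reindex (fun p : 'I_n * bool => dbl p.1 p.2)) /=.
  rewrite -(pair_big xpredT xpredT
    (fun k e => (dbl k e \in dbl_set U V) : nat)) /=.
  by apply: eq_bigr => k _; rewrite big_bool /= !in_dbl_set addnC.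
exists (fun i => (dblh i, odd i)) => [[k e] _|i _] /=; last exact: dblhK.
by rewrite !dblK.
Qed.

(** A surviving set has W inside U and is encoded by the disjoint sets A = U minus W (only the first
    member of the pair chosen) and B = W (both chosen), whence the size |A| + 2 |B|. *)
Lemma sum_dbl_set (V : nmodType) (r : nat) (f : {set 'I_(2 * n)} -> V) :
  (forall U W : {set 'I_n}, ~~ (W \subset U) -> f (dbl_set U W) = 0) ->
  \sum_(I : {set 'I_(2 * n)} | #|I| == r) f I =
  \sum_(p : {set 'I_n} * {set 'I_n} |
      (p.2 \subset ~: p.1) && ((#|p.1| + 2 * #|p.2|)%N == r))
    f (dbl_set (p.1 :|: p.2) p.2).
Proof.
move=> f0.
rewrite (reindex (fun p : {set 'I_n} * {set 'I_n} => dbl_set p.1 p.2)) /=; last first.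
  exists (fun I : {set 'I_(2 * n)} =>
    ([set k | dbl k false \in I], [set k | dbl k true \in I])) => [[U W] _|I _] /=.
    by congr pair; apply/setP => k; rewrite inE in_dbl_set.
  apply/setP => i; rewrite -(dblhK i) in_dbl_set.
  by case: (odd i); rewrite inE.
rewrite (bigID (fun p : {set 'I_n} * {set 'I_n} => p.2 \subset p.1)) /=.
rewrite [X in _ + X]big1 ?addr0 => [|p /andP[_ /f0]] //.
rewrite (reindex_onto (fun p : {set 'I_n} * {set 'I_n} => (p.1 :|: p.2, p.2))
  (fun p => (p.1 :\: p.2, p.2))) /=; last first.
  move=> [U W] /andP[_ WU] /=; congr pair; apply/setP => k; rewrite !inE.
  by have /implyP := subsetP WU k; case: (k \in W); case: (k \in U).
apply: eq_bigl => -[A B] /=; rewrite card_dbl_set subsetUr andbT xpair_eqE eqxx andbT.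
rewrite setDUl setDv setU0 andbC; case: (boolP (B \subset ~: A)) => AB /=.
  have dAB : [disjoint A & B] by rewrite disjoint_sym disjoints_subset.
  by rewrite (setDidPl dAB) eqxx cardsU (disjoint_setI0 dAB) cards0 subn0 mul2n -addnn addnA.
apply/negbTE; rewrite negb_and; apply/orP; left; apply: contra AB => /eqP/setDidPl.
by rewrite disjoint_sym disjoints_subset.
Qed.
End DoubledIndices.

Section DoubledCoefficients.
Variables (F : fieldType) (n : nat) (q t s : F) (h : F -> F).
Hypotheses (s0 : s != 0) (hs : s ^+ 2 = t) (t1 : t != 1).
Implicit Types (A B : {set 'I_n}) (k l : 'I_n).

(* The factor of the ordered pair (k, l) in the product of the density with the
   coefficient of D^r that shifts z_k completely for k in B and by half for k in A;
   here the density is the product of the h (z_k / z_l), whose zeros absorb the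
   poles of the coefficient at u = 1. *)
Definition pair_factor A B k l (u : F) : F :=
  if k \in B then
    if l \in B then h u
    else if l \in A then h (q * u) else h (q * u) * (t * (1 - t * u) / (t - u))
  else if k \in A then
    if l \in B then h u
    else if l \in A then h u * ((1 - t ^+ 2 * u) / (1 - t * u)) else h (q * u)
  else h u.

(** The factor 1 + t is the coefficient inside the pair of some k in A, with s z_k chosen and s^-1
    z_k not: (t s - s^-1) / (s - s^-1) = (t^2 - 1) / (t - 1). *)
Definition pair_prod A B (z : 'I_n -> F) : F :=
  (1 + t) ^+ #|A| *
  \prod_k \prod_(l | l != k) pair_factor A B k l (z k / z l).

Variable z : 'I_n -> F.
Hypotheses (z0 : forall k, z k != 0) (zI : injective z)
  (zt : forall k l, z k != t * z l)
  (hz : forall k l, h (z k / z l) * (1 - t ^+ 2 * (z k / z l)) =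
                    (1 - z k / z l) * h (q * (z k / z l))).

Definition dbl_arg (i : 'I_(2 * n)) : F := (if odd i then s^-1 else s) * z (dblh i).

Definition dbl_coef (I : {set 'I_(2 * n)}) : F :=
  \prod_(i in I) \prod_(j | j \notin I)
    ((t * dbl_arg i - dbl_arg j) / (dbl_arg i - dbl_arg j)).

Let c i j : F := (t * dbl_arg i - dbl_arg j) / (dbl_arg i - dbl_arg j).

Let m (I : {set 'I_(2 * n)}) k l e e' : F :=
  if (dbl k e \in I) && (dbl l e' \notin I) then c (dbl k e) (dbl l e') else 1.

Let coefE I : dbl_coef I = \prod_k \prod_l
  (m I k l false false * m I k l false true * (m I k l true false * m I k l true true)).
Proof.
rewrite /dbl_coef big_mkcond /= (eq_bigr (fun i => \prod_j
   (if (i \in I) && (j \notin I) then c i j else 1))); last first.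
  move=> i _; case: ifP => iI; last by rewrite big1.
  by rewrite big_mkcond.
rewrite prod_dbl; apply: eq_bigr => k _.
by rewrite !prod_dbl -big_split.
Qed.

Let xE k e : dbl_arg (dbl k e) = (if e then s^-1 else s) * z k.
Proof. by rewrite /dbl_arg !dblK. Qed.

(** For x_i = s^-1 z_k chosen and x_j = s z_k not chosen, the numerator t x_i - x_j is zero because
    s^2 = t. *)
Lemma dbl_coef_eq0 (U W : {set 'I_n}) : ~~ (W \subset U) -> dbl_coef (dbl_set U W) = 0.
Proof.
case/subsetPn => k kW kU; rewrite coefE (bigD1 k) //= (bigD1 k) //=.
rewrite {3}/m !in_dbl_set kW kU /= /c !xE /=.
have -> : t * (s^-1 * z k) - s * z k = 0 by rewrite -hs; field.
by rewrite !(mul0r, mulr0).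
Qed.

(** Each ordered pair (k, l) carries up to four coefficients, which depend only on u = z_k / z_l.
    Writing h(qu) as h(u) (1 - t^2 u) / (1 - u) leaves one rational identity in u for each position
    of k and l in A, in B or in neither. *)
Lemma dbl_coefE A B : B \subset ~: A ->
  dbl_coef (dbl_set (A :|: B) B) * (\prod_k \prod_(l | l != k) h (z k / z l)) =
  pair_prod A B z.
Proof.
move=> BA; rewrite coefE /pair_prod.
have -> : (1 + t) ^+ #|A| = \prod_k (if k \in A then 1 + t else 1).
  by rewrite -big_mkcond /= prodr_const.
rewrite -!big_split /=; apply: eq_bigr => k _.
have AB i : i \in B -> (i \in A) = false.
  by move/(subsetP BA); rewrite inE => /negPf.
have red (w p r : F) : w != 0 -> (w * p) / (w * r) = p / r.
  by move=> w0; rewrite -mulf_div divff // mul1r.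
have sV0 : s^-1 != 0 by rewrite invr_neq0.
rewrite (bigD1 k) //= -mulrA; congr (_ * _).
  rewrite /m !in_dbl_set !inE /c !xE; have := AB k.
  case: (k \in B); case: (k \in A) => //= h1; try by have := h1 isT.
  - by rewrite !mulr1.
  - rewrite mul1r !mulr1; move: t1; rewrite -hs -subr_eq0 => s1.
    transitivity ((s^-1 * z k * (s ^+ 4 - 1)) / (s^-1 * z k * (s ^+ 2 - 1))).
      by congr (_ / _); field.
    by rewrite red ?mulf_neq0 //; field.
  - by rewrite !mulr1.
rewrite -big_split /=; apply: eq_bigr => l lk.
set u := z k / z l.
have lk0 : k != l by rewrite eq_sym.
have u1 : u - 1 != 0.
  rewrite subr_eq0 /u; apply: contra lk0 => /eqP/(divr1_eq)/zI->//.
have ut : u - t != 0.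
  by rewrite subr_eq0 /u; apply: contra (zt k l) => /eqP <-; rewrite divfK.
have tu : t * u - 1 != 0.
  rewrite subr_eq0 /u mulrA; apply: contra (zt l k) => /eqP/divr1_eq->//.
have zk : z k = u * z l by rewrite /u divfK.
have cE e : c (dbl k e) (dbl l e) = (t * u - 1) / (u - 1).
  pose w := (if e then s^-1 else s) * z l.
  rewrite -(@red w); last by rewrite /w mulf_neq0 //; case: (e).
  by rewrite /c !xE zk /w; congr (_ / _); ring.
have cft : c (dbl k false) (dbl l true) = (t ^+ 2 * u - 1) / (t * u - 1).
  rewrite -(@red (s^-1 * z l)) ?mulf_neq0 // /c !xE zk -hs.
  by congr (_ / _); field.
have ctf : c (dbl k true) (dbl l false) = t * (u - 1) / (u - t).
  rewrite -(@red (s^-1 * z l)) ?mulf_neq0 // /c !xE zk -hs.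
  by congr (_ / _); field.
have hqu : h (q * u) = h u * (1 - t ^+ 2 * u) / (1 - u).
  rewrite hz -/u mulrAC divff ?mul1r //.
  by rewrite -opprB oppr_eq0.
rewrite /m !in_dbl_set !inE /pair_factor !cE cft ctf -/u hqu.
have opp_neq0 a b : a - b != 0 -> (b - a : F) != 0.
  by rewrite -opprB oppr_eq0.
have u1' := opp_neq0 _ _ u1.
have ut' := opp_neq0 _ _ ut.
have tu' := opp_neq0 _ _ tu.
have := AB k; have := AB l.
case: (k \in B); case: (l \in B); case: (k \in A); case: (l \in A) => //= h1 h2;
  rewrite ?mul1r ?mulr1 //; do ?[by have := h1 isT | by have := h2 isT].
all: field.
all: by rewrite ?u1 ?u1' ?ut ?ut' ?tu ?tu'.
Qed.
End DoubledCoefficients.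

(** * Integration over the circle *)

Section ComplexModulus.
Import trigo.
Variable R : realType.
Local Notation C := R[i].
Local Open Scope complex_scope.
Implicit Types x y z : C.

Lemma normrc x : `|x| = (normc x)%:C. Proof. by []. Qed.

Lemma normc_ge0 x : 0 <= normc x.
Proof. by case: x => a b; exact: sqrtr_ge0. Qed.

Lemma normc_eq0 x : (normc x == 0) = (x == 0).
Proof. by apply/eqP/eqP => [/eq0_normc|->] //; rewrite normc0. Qed.

Lemma normc_gt0 x : (0 < normc x) = (x != 0).
Proof. by rewrite lt_neqAle normc_ge0 andbT eq_sym normc_eq0. Qed.

Lemma normcBC x y : normc (x - y) = normc (y - x).
Proof. by rewrite -normcN opprB. Qed.

Lemma normcX x k : normc (x ^+ k) = normc x ^+ k.
Proof. by elim: k => [|k IH]; rewrite ?expr0 ?normc1 // !exprS normcM IH. Qed.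

Lemma normcXz x (k : int) : normc (x ^ k) = normc x ^ k.
Proof. by case: k => k; rewrite -?exprnP ?NegzE -?exprnN ?normcV normcX. Qed.

Lemma normc_prod (I : Type) (r : seq I) (P : pred I) (f : I -> C) :
  normc (\prod_(i <- r | P i) f i) = \prod_(i <- r | P i) normc (f i).
Proof.
elim/big_rec2: _ => [|i y x _ <-]; first by rewrite normc1.
by rewrite normcM.
Qed.

Lemma le_Re_normc x : `|complex.Re x| <= normc x.
Proof.
by case: x => a b /=; rewrite -sqrtr_sqr ler_wsqrtr // lerDl sqr_ge0.
Qed.

Lemma normc_le_Re_Im x : normc x <= `|complex.Re x| + `|complex.Im x|.
Proof.
case: x => a b /=; rewrite -(@ler_pXn2r _ 2) ?nnegrE ?addr_ge0 ?sqrtr_ge0 //.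
rewrite sqr_sqrtr ?addr_ge0 ?sqr_ge0 // sqrrD !real_normK ?num_real //.
by rewrite addrAC lerDl mulrn_wge0 ?mulr_ge0.
Qed.

Lemma normc_eq0_small x : (forall e : R, 0 < e -> normc x <= e) -> x = 0.
Proof.
move=> H; apply/eqP; rewrite -normc_eq0; apply/negP => /negP x0.
have x1 : 0 < normc x by rewrite lt_neqAle eq_sym x0 normc_ge0.
by have := H (normc x / 2) (divr_gt0 x1 (ltr0Sn _ _)); lra.
Qed.

Lemma normc_expi (u : R) : normc (expi u) = 1.
Proof. by rewrite /expi /= cos2Dsin2 sqrtr1. Qed.

Lemma expiD (u v : R) : expi (u + v) = expi u * expi v.
Proof.
rewrite /expi mulrDr sinD cosD; simpc.
by congr (_ +i* _); ring.
Qed.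

Lemma expi0 : expi 0 = 1 :> C.
Proof. by rewrite /expi mulr0 cos0 sin0. Qed.

Lemma expi1 : expi 1 = 1 :> C.
Proof. by rewrite /expi mulr1 mulr_natl cos2pi sin2pi. Qed.

Lemma expi_neq0 (u : R) : expi u != 0.
Proof. by rewrite -normc_eq0 normc_expi oner_eq0. Qed.

Lemma expiXn (u : R) (k : nat) : expi u ^+ k = expi (k%:R * u).
Proof.
elim: k => [|k IH]; first by rewrite mul0r expi0.
by rewrite exprS IH -expiD mulrS mulrDl mul1r.
Qed.

Lemma expiXz (u : R) (k : int) : expi u ^ k = expi (k%:~R * u).
Proof.
case: k => k; first by rewrite -exprnP expiXn.
rewrite NegzE -exprnN expiXn; apply: (mulIf (expi_neq0 (k.+1%:R * u))).
by rewrite mulVf ?expi_neq0 // -expiD mulrNz mulNr addNr expi0.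
Qed.

End ComplexModulus.

Section CircleMean.
(* imported locally, as [classical_sets] would hide lemmas of [finset] *)
Import boolp classical_sets functions constructive_ereal ereal.
Import topology normedtype sequences derive realfun.
Import exp trigo measure lebesgue_measure lebesgue_integral ftc.
Import numFieldNormedType.Exports.
Variable R : realType.
Local Notation C := R[i].
Local Open Scope complex_scope.
Local Notation mu := (@lebesgue_measure R).
Local Open Scope classical_set_scope.
Implicit Types (p : seq (C * int)) (w : C).

Definition ceval p w : C := \sum_(a <- p) a.1 * w ^ a.2.
Definition cconst p : C := \sum_(a <- p | a.2 == 0) a.1.
(** Used in place of continuity on the circle: it passes through iterated integrals, and the mean
    becomes a limit of constant terms. *)
Definition capprox (h : C -> C) : Prop := forall e : R, 0 < e ->
  exists p, forall w, normc w = 1 -> normc (h w - ceval p w) <= e.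

Let trig (a b c u : R) : R := a * cos (c * u) - b * sin (c * u).

Let is_derive_scale (f df : R -> R) (c u : R) :
  (forall x, is_derive x (1 : R) f (df x)) ->
  is_derive u (1 : R) (fun v : R => f (c * v)) (c * df (c * u)).
Proof.
move=> H.
have H1 : is_derive u (1 : R) (fun v : R => c * v) c.
  by apply: is_derive_eq; rewrite /GRing.scale /= mulr1.
have := @is_derive1_comp _ f (fun v : R => c * v) u _ _ (H _) H1.
by rewrite mulrC.
Qed.

Let continuous_trig a b c : continuous (trig a b c).
Proof.
move=> u; apply: cvgB; apply: cvgMr.
  apply: continuous_comp; last exact: continuous_cos.
  by apply: cvgMr; exact: cvg_id.
apply: continuous_comp; last exact: continuous_sin.
by apply: cvgMr; exact: cvg_id.
Qed.

Let continuous_integrable (f : R -> R) : continuous f ->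
  mu.-integrable `[0, 1] (EFin \o f).
Proof.
move=> cf; apply: continuous_compact_integrable; first exact: segment_compact.
exact: continuous_subspaceT.
Qed.

Let integral_trig a b (k : int) : k != 0 ->
  \int[mu]_(u in `[0, 1]) trig a b (2 * pi * k%:~R) u = 0.
Proof.
move=> k0; set c := _ * _.
have c0 : c != 0.
  by rewrite mulf_neq0 ?intr_eq0 // mulf_neq0 ?pnatr_eq0 // gt_eqF // pi_gt0.
pose F u : R := a / c * sin (c * u) + b / c * cos (c * u).
have dF u : is_derive u (1 : R) F (trig a b c u).
  have ds := @is_derive_scale _ _ c u (@is_derive_sin R).
  have dc := @is_derive_scale _ _ c u (@is_derive_cos R).
  apply: is_derive_eq; rewrite /trig /GRing.scale /=.
  by field.
have cF : continuous F.
  by move=> u; apply: differentiable_continuous; apply/derivable1_diffP.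
rewrite /Rintegral (@continuous_FTC2 _ _ F) //.
(* The boundary terms agree: the real and imaginary parts of e(k) = e(1)^k = 1 give the cosine and
   sine of 2 pi k. *)
- have : expi (k%:~R : R) = 1 by rewrite -(mulr1 k%:~R) -expiXz expi1 exp1rz.
  rewrite /expi => -[] ec es.
  by rewrite /F mulr0 mulr1 sin0 cos0 /c ec es /= subrr.
- by apply: continuous_subspaceT; exact: continuous_trig.
- split => [u _||]; first exact: (@ex_derive _ _ _ _ _ _ _ (dF u)).
    by apply: cvg_at_right_filter; exact: cF.
  by apply: cvg_at_left_filter; exact: cF.
- by move=> u _; rewrite derive1E; exact: derive_val.
Qed.

Let Re_monomial (a : C) (k : int) (u : R) :
  complex.Re (a * expi u ^ k) =
  trig (complex.Re a) (complex.Im a) (2 * pi * k%:~R) u.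
Proof. by rewrite expiXz /expi /trig mulrA; case: a => x y; simpc. Qed.

Let Re_ceval_cons a p u : complex.Re (ceval (a :: p) (expi u)) =
  trig (complex.Re a.1) (complex.Im a.1) (2 * pi * a.2%:~R) u +
  complex.Re (ceval p (expi u)).
Proof. by rewrite /ceval big_cons raddfD /= Re_monomial. Qed.

Let continuous_Re_ceval p : continuous (fun u => complex.Re (ceval p (expi u))).
Proof.
elim: p => [|a p IH].
  suff -> : (fun u => complex.Re (ceval [::] (expi u))) = (fun=> 0).
    by move=> u; exact: cvg_cst.
  by apply/funext => u; rewrite /ceval big_nil.
rewrite (funext (Re_ceval_cons a p)).
move=> u; apply: cvgD; [exact: continuous_trig | exact: IH].
Qed.

Let integral_Re_ceval p :
  \int[mu]_(u in `[0, 1]) complex.Re (ceval p (expi u)) = complex.Re (cconst p).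
Proof.
elim: p => [|a p IH].
  rewrite /cconst big_nil; rewrite /=; under eq_Rintegral do rewrite /ceval big_nil /=.
  by rewrite Rintegral_cst // mul0r.
transitivity (\int[mu]_(u in `[0, 1])
   (trig (complex.Re a.1) (complex.Im a.1) (2 * pi * a.2%:~R) u +
    complex.Re (ceval p (expi u)))).
  by apply: eq_Rintegral => u _; exact: Re_ceval_cons.
rewrite RintegralD //; [|exact/continuous_integrable/continuous_trig
  |exact/continuous_integrable/continuous_Re_ceval].
rewrite IH /cconst big_cons; case: eqP => [->|/eqP a0]; last by rewrite integral_trig ?add0r.
rewrite raddfD /=; congr (_ + _).
transitivity (\int[mu]_(x in `[0, 1]) complex.Re a.1).
  by apply: eq_Rintegral => u _; rewrite /trig mulr0z mulr0 mul0r cos0 sin0 mulr0 subr0 mulr1.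
rewrite Rintegral_cst //= lebesgue_measure_itv /= lte_fin ltr01.
by rewrite oppr0 adde0 /= mulr1.
Qed.

Let ler_dist3 (a b c d e : R) : `|c - d| <= e / 3 -> `|b - d| <= e / 3 ->
  `|a - c| <= e / 3 -> `|a - b| <= e.
Proof.
by rewrite !ler_norml => /andP[? ?] /andP[? ?] /andP[? ?]; apply/andP; split; lra.
Qed.

(** A uniform limit of trigonometric polynomials is continuous, by the usual e/3 argument; this is
    what supplies integrability. *)
Let continuous_capprox (h : C -> C) : capprox h ->
  continuous (fun u => complex.Re (h (expi u))).
Proof.
move=> H u; apply/cvgrPdist_le => /= e e0.
have e3 : 0 < e / 3 by lra.
have [p hp] := H _ e3.
have /cvgrPdist_le/(_ _ e3) := @continuous_Re_ceval p u.
apply: filterS => v /= huv.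
have ap v' : `|complex.Re (h (expi v')) - complex.Re (ceval p (expi v'))| <= e / 3.
  by rewrite -raddfB; apply: le_trans (le_Re_normc _) (hp _ (normc_expi _)).
exact: ler_dist3 huv (ap v) (ap u).
Qed.

Let Re_integral_approx h p (e : R) : capprox h ->
  (forall w, normc w = 1 -> normc (h w - ceval p w) <= e) ->
  `|\int[mu]_(u in `[0, 1]) complex.Re (h (expi u)) - complex.Re (cconst p)| <= e.
Proof.
move=> ah hp; rewrite -integral_Re_ceval -RintegralB //; first last.
- exact/continuous_integrable/continuous_Re_ceval.
- exact/continuous_integrable/continuous_capprox.
have cB : continuous (fun u => complex.Re (h (expi u)) - complex.Re (ceval p (expi u))).
  by move=> u; apply: cvgB; [exact: continuous_capprox|exact: continuous_Re_ceval].
apply: le_trans (le_normr_Rintegral _ _) _ => //.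
  exact: continuous_integrable.
rewrite (_ : e = \int[mu]_(u in `[0, 1]) e); last first.
  rewrite Rintegral_cst //= lebesgue_measure_itv /= lte_fin ltr01.
  by rewrite oppr0 adde0 /= mulr1.
apply: le_Rintegral => //.
- apply: continuous_integrable => u; apply: cvg_norm; exact: cB.
- by apply: continuous_integrable; move=> u; exact: cvg_cst.
move=> u _; rewrite -raddfB.
exact: le_trans (le_Re_normc _) (hp _ (normc_expi _)).
Qed.

Let Im_Re (z : C) : complex.Im z = complex.Re (- 'i * z).
Proof. by case: z => a b; simpc. Qed.

(** The real and the imaginary part each contribute an error e. The imaginary part of h is the real
    part of - i h, which is approximated by the rescaled lists [sc p]. *)
Lemma circle_mean_approx h p (e : R) : capprox h ->
  (forall w, normc w = 1 -> normc (h w - ceval p w) <= e) ->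
  normc (circle_mean h - cconst p) <= 2 * e.
Proof.
move=> ah hp.
pose sc p' := [seq (- 'i * a.1 : C, a.2) | a <- p'].
have scE p' w : ceval (sc p') w = - 'i * ceval p' w.
  by rewrite /ceval big_map big_distrr; apply: eq_bigr => a _ /=; rewrite mulrA.
have scC p' : cconst (sc p') = - 'i * cconst p'.
  by rewrite /cconst big_map big_distrr.
have ni : normc (- 'i : C) = 1 by rewrite normcN /= expr0n add0r expr1n sqrtr1.
have B p' w e' : normc (h w - ceval p' w) <= e' ->
    normc (- 'i * h w - ceval (sc p') w) <= e'.
  by rewrite scE -mulrBr normcM ni mul1r.
apply: le_trans (normc_le_Re_Im _) _; rewrite mulr_natl mulr2n lerD //.
  by rewrite raddfB; exact: Re_integral_approx.
rewrite raddfB /= [complex.Im (cconst _)]Im_Re -scC.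
under eq_Rintegral do rewrite Im_Re.
apply: (@Re_integral_approx (fun w => - 'i * h w)) => [e' e0|w w1]; last exact/B/hp.
by have [p' hp'] := ah e' e0; exists (sc p') => w w1; exact/B/hp'.
Qed.

Lemma circle_mean_ext (h g : C -> C) :
  (forall w, normc w = 1 -> h w = g w) -> circle_mean h = circle_mean g.
Proof.
move=> hg; rewrite /circle_mean.
by congr (_ +i* _); apply: eq_Rintegral => u _; rewrite hg // normc_expi.
Qed.

End CircleMean.

(** * Integration over the torus *)

Section Laurent.
Variable R : realType.
Local Notation C := R[i].
Local Open Scope complex_scope.

Definition lmono n (e : n.-tuple int) (z : n.-tuple C) : C :=
  \prod_(i < n) tnth z i ^ tnth e i.

Definition leval n (p : seq (C * n.-tuple int)) (z : n.-tuple C) : C :=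
  \sum_(a <- p) a.1 * lmono a.2 z.

Definition lconst n (p : seq (C * n.-tuple int)) : C :=
  \sum_(a <- p | all (fun k : int => k == 0) a.2) a.1.

Definition approx n (S : n.-tuple C -> Prop) (f : n.-tuple C -> C) : Prop :=
  forall e : R, 0 < e ->
  exists p, forall z, S z -> normc (f z - leval p z) <= e.

(** Bounded monomials make approximable functions bounded on S, which is what closes them under
    products; nonzero coordinates make exponents additive. *)
Definition lbounded n (S : n.-tuple C -> Prop) : Prop :=
  (forall z, S z -> forall i, tnth z i != 0) /\
  (forall e, exists K : R, forall z, S z -> normc (lmono e z) <= K).

Definition torus n (z : n.-tuple C) : Prop := forall i, normc (tnth z i) = 1.

Definition tscale n (w z : n.-tuple C) : n.-tuple C :=
  [tuple tnth w i * tnth z i | i < n].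

(** Approximability on this union asks for one Laurent polynomial serving both tori at once, and so
    links the integrals over them. *)
Definition two_tori n (w z : n.-tuple C) : Prop :=
  torus z \/ exists2 z', torus z' & z = tscale w z'.

Section Approx.
Variables (n : nat) (S : n.-tuple C -> Prop).
Implicit Types (f g : n.-tuple C -> C) (z : n.-tuple C).

Lemma approx_ext f g : (forall z, S z -> f z = g z) -> approx S f -> approx S g.
Proof.
move=> fg H e e0; have [p hp] := H e e0.
by exists p => z Sz; rewrite -fg //; exact: hp.
Qed.

Lemma approx_sub (S' : n.-tuple C -> Prop) f :
  (forall z, S' z -> S z) -> approx S f -> approx S' f.
Proof.
by move=> sub H e e0; have [p hp] := H e e0; exists p => z /sub; exact: hp.
Qed.

Lemma approx_leval p : approx S (leval p).
Proof. by move=> e e0; exists p => z _; rewrite subrr normc0 ltW. Qed.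

Lemma approx_lim f : (forall e : R, 0 < e ->
  exists2 g, approx S g & forall z, S z -> normc (f z - g z) <= e) -> approx S f.
Proof.
move=> H e e0; have e2 : 0 < e / 2 by lra.
have [g /(_ _ e2)[p hp] hg] := H _ e2.
exists p => z Sz; rewrite -(subrKA (g z)).
by apply: le_trans (le_normcD _ _) _; rewrite [e]splitr lerD ?hg ?hp.
Qed.

Lemma approxD f g : approx S f -> approx S g -> approx S (fun z => f z + g z).
Proof.
move=> hf hg e e0; have e2 : 0 < e / 2 by lra.
have [p hp] := hf _ e2; have [r hr] := hg _ e2.
exists (p ++ r) => z Sz; rewrite /leval big_cat /= opprD addrACA.
by apply: le_trans (le_normcD _ _) _; rewrite [e]splitr lerD ?hp ?hr.
Qed.

Lemma approx_cst c : approx S (fun=> c).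
Proof.
apply: (@approx_ext (leval [:: (c, nseq_tuple n 0)])); last exact: approx_leval.
move=> z _; rewrite /leval big_seq1 /lmono big1 ?mulr1 //= => i _.
by rewrite [tnth (nseq_tuple _ _) _](tnth_nth 0) /= nth_nseq ltn_ord expr0z.
Qed.

Hypothesis bS : lbounded S.

Lemma leval_bounded p : exists2 K : R, 0 <= K & forall z, S z -> normc (leval p z) <= K.
Proof.
elim: p => [|a p [K K0 hK]].
  by exists 0 => // z _; rewrite /leval big_nil normc0.
have [L hL] := bS.2 a.2.
exists (normc a.1 * `|L| + K) => [|z Sz].
  by rewrite addr_ge0 // mulr_ge0 // normc_ge0.
rewrite /leval big_cons; apply: le_trans (le_normcD _ _) _.
rewrite lerD ?hK // normcM ler_wpM2l ?normc_ge0 //.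
exact: le_trans (hL _ Sz) (ler_norm _).
Qed.

Lemma approx_bounded f : approx S f ->
  exists2 K : R, 0 <= K & forall z, S z -> normc (f z) <= K.
Proof.
move=> /(_ 1 ltr01)[p hp]; have [K K0 hK] := leval_bounded p.
exists (1 + K) => [|z Sz]; first by rewrite addr_ge0.
rewrite -(subrK (leval p z) (f z)); apply: le_trans (le_normcD _ _) _.
by rewrite lerD ?hp ?hK.
Qed.

Lemma lmonoD (e e' : n.-tuple int) z : (forall i, tnth z i != 0) ->
  lmono [tuple tnth e i + tnth e' i | i < n] z = lmono e z * lmono e' z.
Proof.
move=> z0; rewrite /lmono -big_split; apply: eq_bigr => i _ /=.
by rewrite tnth_mktuple expfzDr.
Qed.

Lemma leval_mul p r : exists s, forall z, S z -> leval s z = leval p z * leval r z.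
Proof.
exists [seq (a.1 * b.1, [tuple tnth a.2 i + tnth b.2 i | i < n]) | a <- p, b <- r].
move=> z Sz; rewrite /leval big_allpairs_dep /= mulr_suml; apply: eq_bigr => a _.
rewrite mulr_sumr; apply: eq_bigr => b _ /=.
rewrite (lmonoD _ _ (bS.1 _ Sz)); ring.
Qed.

Lemma approxM f g : approx S f -> approx S g -> approx S (fun z => f z * g z).
Proof.
move=> hf hg e e0; have [K K0 hK] := approx_bounded hg.
have K1 : 0 < K + 1 by lra.
have [p hp] := hf _ (divr_gt0 (divr_gt0 e0 (ltr0Sn _ 1)) K1).
have [L L0 hL] := leval_bounded p; have L1 : 0 < L + 1 by lra.
have [r hr] := hg _ (divr_gt0 (divr_gt0 e0 (ltr0Sn _ 1)) L1).
have [s hs] := leval_mul p r; exists s => z Sz; rewrite hs //.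
have -> : f z * g z - leval p z * leval r z =
  (f z - leval p z) * g z + leval p z * (g z - leval r z) by ring.
apply: le_trans (le_normcD _ _) _; rewrite [e]splitr !normcM.
apply: lerD.
  apply: le_trans (ler_pM (normc_ge0 _) (normc_ge0 _) (hp _ Sz) (hK _ Sz)) _.
  rewrite mulrAC ler_pdivrMr // ler_pM2l ?divr_gt0 //; lra.
apply: le_trans (ler_pM (normc_ge0 _) (normc_ge0 _) (hL _ Sz) (hr _ Sz)) _.
rewrite mulrC mulrAC ler_pdivrMr // ler_pM2l ?divr_gt0 //; lra.
Qed.

Lemma approxB f g : approx S f -> approx S g -> approx S (fun z => f z - g z).
Proof.
move=> hf hg; apply: (@approx_ext (fun z => f z + (-1) * g z)).
  by move=> z _; rewrite mulN1r.
by apply: approxD => //; apply: approxM => //; exact: approx_cst.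
Qed.

Lemma approx_prod (I : Type) (r : seq I) (P : pred I) (f : I -> n.-tuple C -> C) :
  (forall i, P i -> approx S (f i)) -> approx S (fun z => \prod_(i <- r | P i) f i z).
Proof.
move=> H; elim: r => [|i r IH].
  by apply: (@approx_ext (fun=> 1)) (approx_cst _) => z _; rewrite big_nil.
have [Pi|nPi] := boolP (P i).
  apply: (@approx_ext (fun z => f i z * \prod_(j <- r | P j) f j z)).
    by move=> z _; rewrite big_cons Pi.
  exact: approxM (H _ Pi) IH.
by apply: approx_ext IH => z _; rewrite big_cons (negPf nPi).
Qed.

Lemma approx_sum (I : Type) (r : seq I) (P : pred I) (f : I -> n.-tuple C -> C) :
  (forall i, P i -> approx S (f i)) -> approx S (fun z => \sum_(i <- r | P i) f i z).
Proof.
move=> H; elim: r => [|i r IH].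
  by apply: (@approx_ext (fun=> 0)) (approx_cst _) => z _; rewrite big_nil.
have [Pi|nPi] := boolP (P i).
  apply: (@approx_ext (fun z => f i z + \sum_(j <- r | P j) f j z)).
    by move=> z _; rewrite big_cons Pi.
  exact: approxD (H _ Pi) IH.
by apply: approx_ext IH => z _; rewrite big_cons (negPf nPi).
Qed.

Lemma approxX f k : approx S f -> approx S (fun z => f z ^+ k).
Proof.
move=> hf; apply: (@approx_ext (fun z => \prod_(i < k) f z)).
  by move=> z _; rewrite prodr_const card_ord.
exact: approx_prod.
Qed.

Lemma approx_coord i (k : int) : approx S (fun z => tnth z i ^ k).
Proof.
apply: (@approx_ext (leval [:: (1, [tuple (if j == i then k else 0) | j < n])])).
  move=> z _; rewrite /leval big_seq1 mul1r /lmono (bigD1 i) //= tnth_mktuple eqxx.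
  by rewrite big1 ?mulr1 // => j /negPf ji; rewrite tnth_mktuple ji expr0z.
exact: approx_leval.
Qed.

End Approx.

Lemma lbounded_torus_scale n (w : n.-tuple C) : (forall i, tnth w i != 0) ->
  lbounded (two_tori w).
Proof.
move=> w0.
have tn (z : n.-tuple C) i : torus z -> tnth z i != 0.
  by move=> tz; rewrite -normc_eq0 tz oner_eq0.
have tm (z : n.-tuple C) e : torus z -> normc (lmono e z) = 1.
  move=> tz; rewrite /lmono normc_prod big1 // => i _.
  by rewrite normcXz tz exp1rz.
split=> [z [tz|[z' tz ->]] i|e].
- exact: tn.
- by rewrite tnth_mktuple mulf_neq0 // tn.
exists (1 + normc (lmono e w)) => z [/tm->|[z' tz ->]].
  by rewrite lerDl normc_ge0.
have -> : lmono e (tscale w z') = lmono e w * lmono e z'.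
  rewrite /lmono -big_split; apply: eq_bigr => i _ /=.
  by rewrite tnth_mktuple expfzMl.
by rewrite normcM (tm z') // mulr1 lerDr.
Qed.

Lemma lbounded_torus n : lbounded (@torus n).
Proof.
have [|H1 H2] := @lbounded_torus_scale n [tuple 1 | i < n].
  by move=> i; rewrite tnth_mktuple oner_eq0.
split=> [z tz|e]; first by apply: H1; left.
by have [K hK] := H2 e; exists K => z tz; apply: hK; left.
Qed.

Definition slice n (p : seq (C * n.+1.-tuple int)) (w : C) : seq (C * n.-tuple int) :=
  [seq (a.1 * w ^ thead a.2, [tuple of behead a.2]) | a <- p].

Lemma leval_slice n (p : seq (C * n.+1.-tuple int)) w (z : n.-tuple C) :
  leval p (cons_tuple w z) = leval (slice p w) z.
Proof.
rewrite /leval big_map; apply: eq_bigr => a _ /=.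
rewrite /lmono big_ord_recl -mulrA tnth0; congr (_ * (_ * _)).
by apply: eq_bigr => i _; rewrite tnthS tnth_behead; congr (_ ^ tnth _ _);
  apply: val_inj; rewrite /= inordK // ltnS.
Qed.

Definition lhead n (p : seq (C * n.+1.-tuple int)) : seq (C * int) :=
  [seq (a.1, thead a.2) | a : C * n.+1.-tuple int <- p &
    all (fun k : int => k == 0) (behead a.2)].

Lemma lconst_slice n (p : seq (C * n.+1.-tuple int)) w :
  lconst (slice p w) = ceval (lhead p) w.
Proof. by rewrite /lconst /ceval /slice /lhead !big_map big_filter. Qed.

Lemma cconst_lhead n (p : seq (C * n.+1.-tuple int)) : cconst (lhead p) = lconst p.
Proof.
rewrite /lconst /cconst /lhead big_map big_filter_cond; apply: eq_bigl => a /=.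
by rewrite andbC; case: a => a [[|k e] //= _]; rewrite /thead (tnth_nth 0).
Qed.

(** Induction on the iterated integral, at a cost of a factor 2 per circle. The inner integral is
    uniformly close to [lhead p], the constant term in the remaining variables, seen as a Laurent
    polynomial in the first; hence it is again approximable on the circle. *)
Lemma torus_integral_approx n (f : n.-tuple C -> C) p (e : R) :
  approx (@torus n) f -> (forall z, torus z -> normc (f z - leval p z) <= e) ->
  normc (torus_integral f - lconst p) <= 2 ^+ n * e.
Proof.
elim: n f p e => [|n IH] f p e hf hp /=.
  have tt : torus ([tuple] : 0.-tuple C) by case.
  rewrite expr0 mul1r; have -> : lconst p = leval p [tuple]; last exact: hp.
  rewrite /leval /lconst; apply: eq_big => [a|a _].
    by rewrite [a.2]tuple0.
  by rewrite /lmono big_ord0 mulr1.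
have tc w (z : n.-tuple C) : normc w = 1 -> torus z -> torus (cons_tuple w z).
  move=> w1 tz i; case: (unliftP ord0 i) => [j|] ->; last by rewrite tnth0.
  by rewrite tnthS.
have sl p' e' : (forall z, torus z -> normc (f z - leval p' z) <= e') ->
    forall w, normc w = 1 ->
    normc (torus_integral (fun z => f (cons_tuple w z)) - ceval (lhead p') w)
      <= 2 ^+ n * e'.
  move=> hp' w w1; rewrite -lconst_slice; apply: IH.
    move=> d d0; have [p2 hp2] := hf d d0.
    exists (slice p2 w) => z tz; rewrite -leval_slice; apply: hp2; exact: tc.
  by move=> z tz; rewrite -leval_slice; apply: hp'; exact: tc.
rewrite -cconst_lhead exprS -mulrA; apply: circle_mean_approx; last exact: sl.
move=> d d0; have d2 : 0 < d / 2 ^+ n by rewrite divr_gt0 // exprn_gt0.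
have [p' hp'] := hf _ d2; exists (lhead p') => w w1.
apply: le_trans (sl _ _ hp' w w1) _.
by rewrite mulrC divfK // gt_eqF // exprn_gt0.
Qed.

Lemma torus_integral_ext n (f g : n.-tuple C -> C) :
  (forall z, torus z -> f z = g z) -> torus_integral f = torus_integral g.
Proof.
elim: n f g => [|n IH] f g fg /=; first by apply: fg; case.
apply: circle_mean_ext => w w1; apply: IH => z tz; apply: fg => i.
by case: (unliftP ord0 i) => [j|] ->; rewrite ?tnth0 ?tnthS.
Qed.

(** Additivity is read off constant terms. With approximants within e / (4 * 2^n), the errors are
    e/4 for f, e/4 for g and e/2 for the sum. *)
Lemma torus_integralD n (f g : n.-tuple C -> C) :
  approx (@torus n) f -> approx (@torus n) g ->
  torus_integral (fun z => f z + g z) = torus_integral f + torus_integral g.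
Proof.
move=> hf hg; apply/eqP; rewrite -subr_eq0; apply/eqP/normc_eq0_small => e e0.
set c : R := 2 ^+ n; have c0 : 0 < c by rewrite exprn_gt0.
have e4 : 0 < e / (4 * c) by rewrite divr_gt0 // mulr_gt0.
have [p hp] := hf _ e4; have [r hr] := hg _ e4.
have Hf := torus_integral_approx hf hp; have Hg := torus_integral_approx hg hr.
have Hfg : normc (torus_integral (fun z => f z + g z) - (lconst p + lconst r)) <=
    2 ^+ n * (e / (4 * c) + e / (4 * c)).
  rewrite (_ : lconst p + lconst r = lconst (p ++ r)); last by rewrite /lconst big_cat.
  apply: torus_integral_approx => [|z tz]; first exact: approxD.
  rewrite /leval big_cat /= opprD addrACA.
  by apply: le_trans (le_normcD _ _) _; rewrite lerD ?hp ?hr.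
set A := torus_integral _; set B := torus_integral f; set D := torus_integral g.
have -> : A - (B + D) = (A - (lconst p + lconst r)) +
   ((lconst p - B) + (lconst r - D)) by ring.
apply: le_trans (le_normcD _ _) _.
have H2 := le_normcD (lconst p - B) (lconst r - D).
have E : c * (e / (4 * c)) = e / 4 by field; rewrite gt_eqF.
rewrite -/c !(mulrDr, E) in Hf Hg Hfg.
rewrite (normcBC (lconst p)) (normcBC (lconst r)) in H2.
rewrite -/A -/B -/D in Hf Hg Hfg.
lra.
Qed.

Lemma torus_integralZ n (c : C) (f : n.-tuple C -> C) : approx (@torus n) f ->
  torus_integral (fun z => c * f z) = c * torus_integral f.
Proof.
move=> hf; apply/eqP; rewrite -subr_eq0; apply/eqP/normc_eq0_small => e e0.
set k : R := 2 ^+ n; have k0 : 0 < k by rewrite exprn_gt0.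
have c1 : 0 < normc c + 1 by have := normc_ge0 c; lra.
(* The summand 1 keeps the denominator positive for c = 0; the total error is e |c| / (|c| + 1). *)
set d := e / (2 * k * (normc c + 1)).
have d0 : 0 < d by rewrite divr_gt0 // !mulr_gt0.
have [p hp] := hf _ d0.
pose cp := [seq (c * a.1, a.2) | a <- p].
have cpE z : leval cp z = c * leval p z.
  by rewrite /leval big_map mulr_sumr; apply: eq_bigr => a _; rewrite mulrA.
have cpC : lconst cp = c * lconst p by rewrite /lconst big_map mulr_sumr.
have Hf := torus_integral_approx hf hp.
have Hcf : normc (torus_integral (fun z => c * f z) - lconst cp) <=
    2 ^+ n * (normc c * d).
  apply: torus_integral_approx => [|z tz].
    by apply: approxM => //; [exact: lbounded_torus|exact: approx_cst].
  by rewrite cpE -mulrBr normcM ler_wpM2l ?normc_ge0 ?hp.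
move: Hf Hcf; set A := torus_integral _; set B := torus_integral _ => Hf Hcf.
have -> : B - c * A = (B - lconst cp) + c * (lconst p - A) by rewrite cpC; ring.
apply: le_trans (le_normcD _ _) _.
have H2 : normc (c * (lconst p - A)) <= normc c * (k * d).
  by rewrite normcM ler_wpM2l ?normc_ge0 // normcBC.
apply: le_trans (lerD Hcf H2) _.
rewrite -/k (_ : _ + _ = e * (normc c / (normc c + 1))); last first.
  by rewrite /d; field; rewrite !gt_eqF.
by rewrite ler_piMr ?(ltW e0) // ler_pdivrMr // mul1r lerDl.
Qed.

Lemma torus_integral_sum n (I : Type) (r : seq I) (P : pred I)
    (f : I -> n.-tuple C -> C) : (forall i, P i -> approx (@torus n) (f i)) ->
  torus_integral (fun z => \sum_(i <- r | P i) f i z) =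
  \sum_(i <- r | P i) torus_integral (f i).
Proof.
move=> H; elim: r => [|i r IH].
  rewrite big_nil -[RHS](mul0r (torus_integral (fun _ : n.-tuple C => 0))).
  rewrite -torus_integralZ; last exact: approx_cst.
  by apply: torus_integral_ext => z _; rewrite big_nil mul0r.
rewrite big_cons; have [Pi|nPi] := boolP (P i); last first.
  by rewrite -IH; apply: torus_integral_ext => z _; rewrite big_cons (negPf nPi).
rewrite -IH -torus_integralD; last exact: approx_sum.
  by apply: torus_integral_ext => z _; rewrite big_cons Pi.
exact: H.
Qed.

Definition lscale n (w : n.-tuple C) (p : seq (C * n.-tuple int)) :
    seq (C * n.-tuple int) := [seq (a.1 * lmono a.2 w, a.2) | a <- p].

Lemma leval_lscale n (w : n.-tuple C) p z :
  leval (lscale w p) z = leval p (tscale w z).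
Proof.
rewrite /leval big_map; apply: eq_bigr => a _; rewrite -mulrA /lmono -big_split /=.
by congr (_ * _); apply: eq_bigr => i _; rewrite tnth_mktuple expfzMl.
Qed.

Lemma lconst_lscale n (w : n.-tuple C) p : lconst (lscale w p) = lconst p.
Proof.
rewrite /lconst big_map; apply: eq_bigr => a /allP a0.
rewrite /lmono big1 ?mulr1 // => i _.
by rewrite (eqP (a0 _ (mem_tnth _ _))) expr0z.
Qed.

Lemma approx_two_tori n (w : n.-tuple C) f :
  approx (two_tori w) f -> approx (@torus n) f.
Proof. by apply: approx_sub => z tz; left. Qed.

Lemma approx_two_tori_scale n (w : n.-tuple C) f :
  approx (two_tori w) f -> approx (@torus n) (fun z => f (tscale w z)).
Proof.
move=> hf d /hf[r hr]; exists (lscale w r) => z tz; rewrite leval_lscale.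
by apply: hr; right; exists z.
Qed.

(* A Laurent polynomial and its rescaling have the same constant term, so no
   contour deformation is needed: uniform approximability on the two tori
   suffices. *)
Lemma torus_integral_scale n (w : n.-tuple C) (f : n.-tuple C -> C) :
  approx (two_tori w) f ->
  torus_integral (fun z => f (tscale w z)) = torus_integral f.
Proof.
move=> hf; apply/eqP; rewrite -subr_eq0; apply/eqP/normc_eq0_small => e e0.
set k : R := 2 ^+ n; have k0 : 0 < k by rewrite exprn_gt0.
have d0 : 0 < e / (2 * k) by rewrite divr_gt0 // mulr_gt0.
have [p hp] := hf _ d0.
have Hf : normc (torus_integral f - lconst p) <= k * (e / (2 * k)).
  apply: torus_integral_approx => [|z tz]; last by apply: hp; left.
  exact: approx_two_tori hf.
have : normc (torus_integral (fun z => f (tscale w z)) - lconst (lscale w p))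
    <= k * (e / (2 * k)).
  apply: torus_integral_approx => [|z tz]; first exact: approx_two_tori_scale.
  by rewrite leval_lscale; apply: hp; right; exists z.
rewrite lconst_lscale; move: Hf.
set A := torus_integral _; set B := torus_integral _ => Hf Hb.
rewrite -(subrKA (lconst p)); apply: le_trans (le_normcD _ _) _.
rewrite (normcBC (lconst p)); apply: le_trans (lerD Hb Hf) _.
by rewrite (_ : _ + _ = e) //; field; rewrite gt_eqF.
Qed.

End Laurent.

(** * q-Pochhammer symbols *)

Section QPochhammer.
Import boolp classical_sets functions topology normedtype sequences exp.
Import numFieldNormedType.Exports.
Variable R : realType.
Local Notation C := R[i].
Local Open Scope complex_scope.
Local Open Scope classical_set_scope.

Lemma geom_small (D r e : R) : 0 <= r < 1 -> 0 < e ->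
  exists M, forall m, (M <= m)%N -> D * r ^+ m <= e.
Proof.
move=> /andP[r0 r1] e0; have := @cvg_geometric R D r.
rewrite ger0_norm // => /(_ r1) /cvgrPdist_le/(_ e e0)[M _ HM].
exists M => m Mm; have := HM m Mm; rewrite /geometric /= sub0r normrN.
exact: le_trans (ler_norm _).
Qed.

Lemma geom_cvg_real (u : nat -> R) (D r : R) : 0 <= r < 1 ->
  (forall m, `|u m.+1 - u m| <= D * r ^+ m) ->
  exists l, forall m, `|u m - l| <= D / (1 - r) * r ^+ m.
Proof.
move=> r01 H; have /andP[r0 r1] := r01; have r1' : 0 < 1 - r by lra.
have D0 : 0 <= D by have := H 0; rewrite expr0 mulr1; exact: le_trans.
have : cvgn (series (fun k => u k.+1 - u k)).
  apply: normed_cvg; apply: (@series_le_cvg _ _ (geometric D r)) => [k|k|k|] //.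
  - by rewrite /= normr_ge0.
  - by rewrite /geometric /= mulr_ge0 // exprn_ge0.
  - exact: H.
  - by apply: is_cvg_geometric_series; rewrite ger0_norm.
move=> /cvg_ex[l' Hl]; exists (u 0%N + l') => m.
have tel k : series (fun k => u k.+1 - u k) k = u k - u 0.
  by rewrite /series /= telescope_sumr.
(* The sharper bound with 1 - r^j, a geometric partial sum, is what makes the induction close. *)
have step j : `|u (m + j)%N - u m| <= D / (1 - r) * r ^+ m * (1 - r ^+ j).
  elim: j => [|j IH]; first by rewrite addn0 subrr normr0 expr0 subrr mulr0.
  rewrite -(subrKA (u (m + j)%N)); apply: le_trans (ler_normD _ _) _.
  rewrite addnS; apply: le_trans (lerD (H _) IH) _.
  rewrite exprD exprS le_eqVlt; apply/orP; left; apply/eqP; field.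
  by rewrite gt_eqF.
apply/ler_addgt0Pr => e e0.
have /cvgrPdist_le/(_ e e0)[M _ HM] := Hl.
have := HM (m + M)%N (leq_addl _ _); rewrite /= tel => Hd.
have := step M; set U := u (m + M)%N => Hs.
have E : D / (1 - r) * r ^+ m * (1 - r ^+ M) <= D / (1 - r) * r ^+ m.
  rewrite ler_piMr //; last by rewrite gerBl exprn_ge0.
  by apply: mulr_ge0; [apply: divr_ge0 => //; exact: ltW | exact: exprn_ge0].
have -> : u m - (u 0 + l') = (u m - U) - (l' - (U - u 0)) by ring.
apply: le_trans (ler_normB _ _) _; apply: lerD Hd.
by rewrite distrC; exact: le_trans Hs E.
Qed.

Lemma geom_cvg (u : nat -> C) (D r : R) : 0 <= r < 1 ->
  (forall m, normc (u m.+1 - u m) <= D * r ^+ m) ->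
  exists l, forall m, normc (u m - l) <= 2 * (D / (1 - r)) * r ^+ m.
Proof.
move=> r01 H.
have [lr Hr] : exists l, forall m, `|complex.Re (u m) - l| <= D / (1 - r) * r ^+ m.
  apply: geom_cvg_real => // m; rewrite -raddfB.
  exact: le_trans (le_Re_normc _) (H _).
have [li Hi] : exists l, forall m, `|complex.Im (u m) - l| <= D / (1 - r) * r ^+ m.
  apply: geom_cvg_real => // m; rewrite -raddfB; apply: le_trans (H m).
  by case: (_ - _) => a b /=; rewrite -sqrtr_sqr ler_wsqrtr // lerDr sqr_ge0.
exists (lr +i* li) => m; rewrite -mulrA mulr_natl mulr2n.
apply: le_trans (normc_le_Re_Im _) _; rewrite !raddfB /=.
exact: lerD.
Qed.

Variable q : C.
Hypothesis q1 : normc q < 1.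
Let r := normc q.
Let r01 : 0 <= r < 1. Proof. by rewrite normc_ge0. Qed.
Let r0 : 0 <= r. Proof. by rewrite normc_ge0. Qed.
Let r1' : 0 < 1 - r. Proof. by rewrite subr_gt0. Qed.

Definition qpoch_part (a : C) (m : nat) : C := \prod_(k < m) (1 - a * q ^+ k).

Lemma prod1D_le (A : R) (m : nat) : 0 <= A ->
  \prod_(k < m) (1 + A * r ^+ k) <= expR (A / (1 - r)).
Proof.
move=> A0; apply: (@le_trans _ _ (expR (\sum_(k < m) A * r ^+ k))).
  rewrite expR_sum; apply: ler_prod => k _.
  by rewrite expR_ge1Dx addr_ge0 // mulr_ge0 ?exprn_ge0.
have E : (1 - r) * (\sum_(k < m) r ^+ k) = 1 - r ^+ m.
  by rewrite -opprB mulNr -subrX1 opprB.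
rewrite ler_expR -mulr_sumr ler_wpM2l // -(ler_pM2l r1') E mulfV ?gt_eqF //.
by rewrite gerBl exprn_ge0.
Qed.

Lemma qpoch_part_bound (A : R) a m : normc a <= A ->
  normc (qpoch_part a m) <= expR (A / (1 - r)).
Proof.
move=> aA; have A0 : 0 <= A := le_trans (normc_ge0 _) aA.
apply: le_trans (prod1D_le m A0); rewrite normc_prod; apply: ler_prod => k _.
rewrite normc_ge0 /=; apply: le_trans (le_normcD _ _) _.
by rewrite normc1 normcN normcM normcX lerD2l ler_wpM2r // exprn_ge0.
Qed.

(** For |a| <= A consecutive partial products differ by at most exp(A / (1 - r)) A r^m; [geom_cvg]
    adds the factor 2 / (1 - r). The constant depends on A only, so convergence is uniform in a. *)
Let K (A : R) : R := 2 * (expR (A / (1 - r)) * A / (1 - r)).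

Lemma qpoch_cvg (A : R) a m : normc a <= A ->
  normc (qpoch_part a m - qpoch a q) <= K A * r ^+ m.
Proof.
move=> aA; have A0 : 0 <= A := le_trans (normc_ge0 _) aA.
have [l Hl] : exists l, forall m, normc (qpoch_part a m - l) <= K A * r ^+ m.
  apply: geom_cvg => // k; rewrite /qpoch_part big_ord_recr /=.
  rewrite mulrBr mulr1 addrAC subrr add0r normcN !normcM normcX.
  rewrite -[X in _ <= X]mulrA ler_pM ?mulr_ge0 ?normc_ge0 ?exprn_ge0 //.
    exact: qpoch_part_bound.
  by rewrite ler_wpM2r // exprn_ge0.
suff -> : qpoch a q = l by [].
apply: (@cvg_lim C^o (@norm_hausdorff _ C^o) nat \oo _ (qpoch_part a : nat -> C^o) l).
apply/cvgrPdist_le => /= e e0.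
(* The norm of [C^o] is complex valued, so e is a positive element of C and has to be brought back
   to a real number. *)
have eE : e = (complex.Re e)%:C by rewrite RRe_real // gtr0_real.
have e0' : 0 < complex.Re e by move: e0; rewrite {1}eE ltcR.
have [M HM] := geom_small (K A) r01 e0'.
exists M => // k /= Mk; rewrite eE normrc lecR normcBC.
exact: le_trans (Hl k) (HM k Mk).
Qed.

Lemma qpochS a : qpoch a q = (1 - a) * qpoch (q * a) q.
Proof.
apply/eqP; rewrite -subr_eq0; apply/eqP/normc_eq0_small => e e0.
pose A := normc a + normc (q * a).
have aA : normc a <= A by rewrite lerDl normc_ge0.
have qaA : normc (q * a) <= A by rewrite lerDr normc_ge0.
have [M HM] := geom_small ((1 + normc (1 - a)) * K A) r01 e0.
have partS : qpoch_part a M.+1 = (1 - a) * qpoch_part (q * a) M.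
  rewrite /qpoch_part big_ord_recl expr0 mulr1; congr (_ * _).
  by apply: eq_bigr => k _; rewrite /= /bump add1n exprS mulrA (mulrC a).
have -> : qpoch a q - (1 - a) * qpoch (q * a) q =
  (qpoch a q - qpoch_part a M.+1) +
  (1 - a) * (qpoch_part (q * a) M - qpoch (q * a) q) by rewrite partS; ring.
have Kr : 0 <= K A * r ^+ M.
  by apply: le_trans (qpoch_cvg M aA); rewrite normc_ge0.
apply: le_trans (le_normcD _ _) _; rewrite normcBC normcM.
apply: le_trans (HM M (leqnn _)); rewrite -mulrA mulrDl mul1r; apply: lerD.
  apply: le_trans (qpoch_cvg _ aA) _; rewrite exprS mulrCA ler_piMl // ltW //.
by rewrite ler_wpM2l ?normc_ge0 // qpoch_cvg.
Qed.

Lemma qpoch1 : qpoch 1 q = 0.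
Proof. by rewrite qpochS subrr mul0r. Qed.

(** Since 1 / (1 - x) <= 1 + x / (1 - A) for 0 <= x <= A, the reciprocal of the product of the 1 - A
    r^k falls under the upper bound [prod1D_le] with A / (1 - A) for A. *)
Lemma qpoch_part_lower (A : R) a m : A < 1 -> normc a <= A ->
  (expR (A / (1 - A) / (1 - r)))^-1 <= normc (qpoch_part a m).
Proof.
move=> A1 aA; have A0 : 0 <= A := le_trans (normc_ge0 _) aA.
have A1' : 0 < 1 - A by lra.
have B0 : 0 <= A / (1 - A) by rewrite divr_ge0 // ltW.
have ark k : A * r ^+ k <= A by rewrite ler_piMr // exprn_ile1 // ltW.
have P0 : 0 < \prod_(k < m) (1 - A * r ^+ k).
  by apply: prodr_gt0 => k _; rewrite subr_gt0; apply: le_lt_trans A1.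
apply: (@le_trans _ _ (\prod_(k < m) (1 - A * r ^+ k))).
  rewrite -[X in _ <= X]invrK lef_pV2 ?posrE ?invr_gt0 ?expR_gt0 //.
  apply: le_trans (prod1D_le m B0); rewrite -prodfV; apply: ler_prod => k _.
  have h1 := ark k; have h0 : 0 <= A * r ^+ k by rewrite mulr_ge0 ?exprn_ge0.
  set x := A * r ^+ k in h1 h0 *; have x1 : 0 < 1 - x by lra.
  rewrite invr_ge0 ltW //= mulrAC -/x -(ler_pM2r x1) mulVf ?gt_eqF //.
  rewrite -subr_ge0 (_ : _ - 1 = x * (A - x) / (1 - A)); last by field; rewrite gt_eqF.
  apply: divr_ge0; last exact: ltW.
  by apply: mulr_ge0 => //; rewrite subr_ge0.
rewrite normc_prod; apply: ler_prod => k _.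
rewrite subr_ge0 (le_trans (ark k) (ltW A1)) /=.
have H : normc 1 <= normc (1 - a * q ^+ k) + normc (a * q ^+ k).
  by rewrite -[X in normc X <= _](subrK (a * q ^+ k)) le_normcD.
rewrite normc1 normcM normcX in H.
by rewrite lerBlDr; apply: le_trans H _; rewrite lerD2l ler_wpM2r // exprn_ge0 // normc_ge0.
Qed.

Lemma qpoch_lower_bound (A : R) a : A < 1 -> normc a <= A ->
  (expR (A / (1 - A) / (1 - r)))^-1 <= normc (qpoch a q).
Proof.
move=> A1 aA; apply/ler_addgt0Pr => e e0.
have [M HM] := geom_small (K A) r01 e0.
apply: le_trans (qpoch_part_lower M A1 aA) _.
rewrite -[qpoch_part a M](subrK (qpoch a q)) addrC.
apply: le_trans (le_normcD _ _) _; rewrite lerD2l.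
exact: le_trans (qpoch_cvg M aA) (HM M (leqnn _)).
Qed.

Section ApproxQPochhammer.
Variables (n : nat) (S : n.-tuple C -> Prop) (v : n.-tuple C -> C).
Hypotheses (bS : lbounded S) (av : approx S v).

Lemma approx_qpoch_part m : approx S (fun z => qpoch_part (v z) m).
Proof.
apply: approx_prod => // k _; apply: approxB => //; first exact: approx_cst.
by apply: approxM => //; exact: approx_cst.
Qed.

Lemma approx_qpoch (A : R) : (forall z, S z -> normc (v z) <= A) ->
  approx S (fun z => qpoch (v z) q).
Proof.
move=> vA; apply: approx_lim => e e0.
have [M HM] := geom_small (K A) r01 e0.
exists (fun z => qpoch_part (v z) M) => [|z Sz]; first exact: approx_qpoch_part.
by rewrite normcBC; apply: le_trans (qpoch_cvg M (vA z Sz)) (HM M (leqnn _)).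
Qed.

Lemma approx_geometric (A : R) : A < 1 -> (forall z, S z -> normc (v z) <= A) ->
  approx S (fun z => (1 - v z)^-1).
Proof.
move=> A1 vA; apply: approx_lim => e e0.
have A1' : 0 < 1 - A by lra.
(* The bound 0 <= A is deduced from a point of S, so the empty set is treated apart. *)
have [->|[z0 Sz0]] : S = (fun=> False) \/ exists z, S z.
  have [|nS] := pselect (exists z, S z); [by right|left].
  by apply/funext => z; apply/propext; split=> // Sz; apply: nS; exists z.
  by exists v => //; apply: approx_sub av.
have A0 : 0 <= A := le_trans (normc_ge0 _) (vA _ Sz0).
have A01 : 0 <= A < 1 by rewrite A0.
have [M HM] := geom_small (1 - A)^-1 A01 e0.
exists (fun z => \sum_(k < M) v z ^+ k) => [|z Sz].
  by apply: approx_sum => k _; exact: approxX.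
have v1 : 1 - A <= normc (1 - v z).
  have := le_normcD (1 - v z) (v z); rewrite subrK normc1.
  by have := vA z Sz; lra.
have nv : 1 - v z != 0 by rewrite -normc_gt0; apply: lt_le_trans v1.
have -> : (1 - v z)^-1 - \sum_(k < M) v z ^+ k = v z ^+ M / (1 - v z).
  apply: (mulfI nv); rewrite mulrBr mulfV // mulrCA mulfV // mulr1.
  suff -> : (1 - v z) * (\sum_(k < M) v z ^+ k) = 1 - v z ^+ M by ring.
  by rewrite -opprB mulNr -subrX1 opprB.
rewrite normcM normcV normcX mulrC; apply: le_trans (HM M (leqnn _)).
apply: ler_pM; rewrite ?invr_ge0 ?exprn_ge0 ?normc_ge0 //.
  by rewrite lef_pV2 ?posrE //; apply: lt_le_trans v1.
by rewrite lerXn2r ?nnegrE ?normc_ge0 // vA.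
Qed.

End ApproxQPochhammer.

Lemma approx_qpochV n (S : n.-tuple C -> Prop) (v : n.-tuple C -> C) (A : R) :
  lbounded S -> approx S v -> A < 1 ->
  (forall z, S z -> normc (v z) <= A) -> approx S (fun z => (qpoch (v z) q)^-1).
Proof.
move=> bS av A1 vA; apply: approx_lim => e e0.
set c := (expR (A / (1 - A) / (1 - r)))^-1.
have c0 : 0 < c by rewrite invr_gt0 expR_gt0.
(* The reciprocals differ by (y - x) / (x y), and c is a lower bound for both moduli. *)
have [M HM] := geom_small (K A / (c * c)) r01 e0.
exists (fun z => (qpoch_part (v z) M)^-1) => [|z Sz].
  apply: (@approx_ext _ _ _ (fun z => \prod_(k < M) (1 - v z * q ^+ k)^-1)).
    by move=> z _; rewrite prodfV.
  apply: approx_prod => // k _; apply: (@approx_geometric _ _ _ _ _ A) => //.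
    by apply: approxM => //; exact: approx_cst.
  move=> z Sz; rewrite normcM normcX -[A]mulr1.
  by rewrite ler_pM ?normc_ge0 ?exprn_ge0 ?vA // exprn_ile1 // ltW.
have h1 := qpoch_lower_bound A1 (vA z Sz); have h2 := qpoch_part_lower M A1 (vA z Sz).
set x := qpoch _ _ in h1 *; set y := qpoch_part _ _ in h2 *.
have nx : 0 < normc x by apply: lt_le_trans h1.
have ny : 0 < normc y by apply: lt_le_trans h2.
have -> : x^-1 - y^-1 = (y - x) / (x * y).
  by field; rewrite -!normc_gt0 nx ny.
rewrite normcM normcV normcM; apply: le_trans (HM M (leqnn _)).
rewrite mulrAC; apply: ler_pM; rewrite ?invr_ge0 ?mulr_ge0 ?normc_ge0 //.
  exact: qpoch_cvg (vA z Sz).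
by rewrite lef_pV2 ?posrE ?mulr_gt0 // ler_pM // ltW.
Qed.

End QPochhammer.

(** * Shifted products over pairs *)

Section ElementarySymmetric.
Variables (F : fieldType) (N : nat) (X : 'I_N -> F).

Definition elsym (r : nat) : F := \sum_(h : {set 'I_N} | #|h| == r) \prod_(i in h) X i.

Lemma sum_set_card (G : nat -> F) (f : {set 'I_N} -> F) :
  \sum_(h : {set 'I_N}) G #|h| * f h =
  \sum_(r < N.+1) G r * \sum_(h : {set 'I_N} | #|h| == r) f h.
Proof.
under [RHS]eq_bigr do rewrite mulr_sumr big_mkcond /=.
rewrite exchange_big /=; apply: eq_bigr => h _.
have hN : (#|h| < N.+1)%N by rewrite ltnS -[N in (_ <= N)%N]card_ord max_card.
rewrite (bigD1 (Ordinal hN)) //= eqxx big1 ?addr0 // => i.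
by rewrite -val_eqE /= eq_sym => /negPf->.
Qed.

Lemma prod_addl v : \prod_i (v + X i) = \sum_(r < N.+1) v ^+ r * elsym (N - r).
Proof.
transitivity (\sum_(r < N.+1) v ^+ (N - r) * elsym r); last first.
  rewrite [RHS](reindex_inj rev_ord_inj) /=; apply: eq_bigr => r _.
  by rewrite subSS subKn // -ltnS.
rewrite -(sum_set_card (fun r => v ^+ (N - r))).
under eq_bigr do rewrite addrC.
rewrite bigA_distr /=; apply: eq_bigr => h _.
rewrite (bigID (mem h)) /= mulrC; congr (_ * _); last by apply: eq_bigr => i ->.
rewrite (eq_bigr (fun=> v)) => [|i /negPf->//]; rewrite prodr_const.
congr (_ ^+ _); rewrite -[X in (X - _)%N](card_ord N) -(cardC h) addKn.
by apply: eq_card.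
Qed.

Lemma prod_1addl w : \prod_i (1 + w * X i) = \sum_(r < N.+1) w ^+ r * elsym r.
Proof.
rewrite -(sum_set_card (fun r => w ^+ r)).
under eq_bigr do rewrite addrC.
rewrite bigA_distr /=; apply: eq_bigr => h _.
rewrite (bigID (mem h)) /= [X in _ * X]big1 ?mulr1 => [|i /negPf->//].
rewrite (eq_bigr (fun i => w * X i)) => [|i ->//].
by rewrite big_split prodr_const.
Qed.

(** The hypothesis says that the product of the v + X_j equals K times the product of the 1 + v rho
    X_j, for all v. At v = - X_i the left side vanishes, so some factor 1 - rho X_i X_j on the right
    does too. *)
Lemma elsym_reflect (K rho : F) : K != 0 ->
  (forall r, (r <= N)%N -> elsym (N - r) = K * rho ^+ r * elsym r) ->
  forall i, exists j, rho * X i * X j = 1.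
Proof.
move=> K0 H i; have : \prod_j (- X i + X j) = K * \prod_j (1 + - X i * rho * X j).
  rewrite prod_addl prod_1addl mulr_sumr; apply: eq_bigr => r _.
  rewrite H; last by rewrite -ltnS.
  by rewrite exprMn; ring.
rewrite (bigD1 i) //= addNr mul0r => /esym/eqP.
rewrite mulf_eq0 (negPf K0) /=; case/prodf_eq0 => j _ /eqP E.
by exists j; apply/esym/eqP; rewrite -subr_eq0 -E; apply/eqP; ring.
Qed.

End ElementarySymmetric.

Section OffDiagonalProducts.
Variables (F : comNzRingType) (I : finType).

Lemma prod_cross (B N : {set I}) (f g : I -> I -> F) : [disjoint B & N] ->
  \prod_k \prod_(l | l != k)
    ((if (k \in B) && (l \in N) then f k l else 1) *
     (if (k \in N) && (l \in B) then g k l else 1)) =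
  \prod_(k in B) \prod_(l in N) (f k l * g l k).
Proof.
move=> dBN.
have ne k l : (k \in B) -> (l \in N) -> l != k.
  by move=> kB lN; apply: contraTneq kB => <-; rewrite (disjointFl dBN).
under eq_bigr do rewrite big_split /=.
rewrite big_split /=.
under [RHS]eq_bigr do rewrite big_split /=.
rewrite [RHS]big_split /=; congr (_ * _).
  rewrite [RHS]big_mkcond; apply: eq_bigr => k _ /=; case: ifP => kB.
    rewrite [RHS]big_mkcond [LHS]big_mkcond; apply: eq_bigr => l _ /=.
    by case: ifP => [|/negbT]; case: ifP => // lN; rewrite (ne _ _ kB lN).
  by rewrite big1.
rewrite [RHS](exchange_big_dep (mem N)) //= [RHS]big_mkcond.
apply: eq_bigr => k _ /=; case: ifP => kN; last by rewrite big1.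
rewrite [RHS]big_mkcond [LHS]big_mkcond; apply: eq_bigr => l _ /=.
rewrite kN andbT /=; case lB: (l \in B); last by rewrite if_same.
by rewrite eq_sym (ne _ _ lB kN).
Qed.

Lemma prod_lt_offdiag (n : nat) (f : 'I_n -> 'I_n -> F) :
  \prod_(i < n) \prod_(j < n | (i < j)%N) (f i j * f j i) =
  \prod_i \prod_(j | j != i) f i j.
Proof.
rewrite (eq_bigr (fun i : 'I_n => (\prod_(j < n | (i < j)%N) f i j) *
    \prod_(j < n | (i < j)%N) f j i)) => [|i _]; last by rewrite -big_split.
rewrite big_split /= [X in _ * X](exchange_big_dep xpredT) //= -big_split /=.
apply: eq_bigr => i _; rewrite [RHS](bigID (fun j : 'I_n => (i < j)%N)) /=.
by congr (_ * _); apply: eq_bigl => j; rewrite -val_eqE /= neq_ltn;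
  case: ltngtP.
Qed.

Lemma prod_offdiag0 (f : I -> I -> F) k l : k != l -> (f k l == 0) || (f l k == 0) ->
  \prod_i \prod_(j | j != i) f i j = 0.
Proof.
have H i j : j != i -> f i j = 0 -> \prod_i \prod_(j | j != i) f i j = 0.
  by move=> ji fij; rewrite (bigD1 i) //= (bigD1 j) //= fij !mul0r.
by move=> kl /orP[] /eqP; apply: H; rewrite // eq_sym.
Qed.

End OffDiagonalProducts.

(** * Pair products after the substitution z_k -> q^-1 z_k *)

Section ShiftedPairProducts.
Variables (F : fieldType) (n : nat) (q t : F) (h : F -> F).
Hypotheses (q0 : q != 0) (t0 : t != 0) (h1 : h 1 = 0).
Implicit Types (A B : {set 'I_n}) (k l : 'I_n) (z : 'I_n -> F).

Definition qshift B z k : F := (if k \in B then q^-1 else 1) * z k.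

Lemma pair_prod_coincident A B z k l : k != l -> z k = z l -> z l != 0 ->
  B \subset ~: A -> pair_prod q t h A B z = 0.
Proof.
move=> kl zkl z0 BA; rewrite /pair_prod (prod_offdiag0 kl) ?mulr0 //.
have := subsetP BA k; have := subsetP BA l; rewrite !inE.
rewrite /pair_factor zkl divff //.
case: (k \in B); case: (l \in B); case: (k \in A); case: (l \in A) => //= H H';
  rewrite ?h1 ?mul0r ?eqxx ?orbT //; do ?[by have := H isT | by have := H' isT].
Qed.

Lemma pair_prod_qshift_coincident A B z k l : k != l -> z k = z l -> z l != 0 ->
  B \subset ~: A -> pair_prod q t h A B (qshift B z) = 0.
Proof.
move=> kl zkl z0 BA; rewrite /pair_prod (prod_offdiag0 kl) ?mulr0 //.
have := subsetP BA k; have := subsetP BA l; rewrite !inE.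
have E1 : q * (q^-1 * z l / (1 * z l)) = 1 by field; rewrite z0 q0.
have E2 : q^-1 * z l / (q^-1 * z l) = 1 by rewrite divff // mulf_neq0 ?invr_neq0.
have E3 : 1 * z l / (1 * z l) = 1 by rewrite mul1r divff.
rewrite /pair_factor /qshift zkl.
case kB: (k \in B); case lB: (l \in B); case kA: (k \in A); case lA: (l \in A) => //= H H';
  rewrite ?E1 ?E2 ?E3 ?h1 ?mul0r ?eqxx ?orbT //; do ?[by have := H isT | by have := H' isT].
Qed.

Variable z : 'I_n -> F.
Hypotheses (z0 : forall k, z k != 0) (zI : injective z)
  (zg : forall k l, z k != t * q * z l)
  (hz : forall k l, h (z k / z l) * (1 - t ^+ 2 * (z k / z l)) =
                    (1 - z k / z l) * h (q * (z k / z l))).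

(** What the factor of (k, l) has in common for all B once the substitution is made. *)
Definition common_factor A k l : F :=
  let u := z k / z l in
  if (k \in A) && (l \in A) then h u * ((1 - t ^+ 2 * u) / (1 - t * u))
  else if k \in A then h (q * u) else h u.

(** Only pairs joining k in B to l in N deviate from the common factor: by [f k l] for (k, l) and by
    [g l k] for (l, k). Their product is t^2 times [rphi] at parameters t^2 and q/t, whose product
    is ga = t q. *)
Lemma pair_prod_qshift A B : B \subset ~: A ->
  pair_prod q t h A B (qshift B z) =
  (1 + t) ^+ #|A| * (\prod_k \prod_(l | l != k) common_factor A k l) *
  ((t ^+ 2) ^+ (#|B| * #|~: A :\: B|) *
   rweight z (t ^+ 2) (q / t) B (~: A :\: B)).
Proof.
move=> BA; rewrite /pair_prod -mulrA; congr (_ * _).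
pose f k l : F := let u := z k / z l in t * (1 - t * (u / q)) / (t - u / q).
pose g k l : F := let u := z k / z l in (1 - t ^+ 2 * u) / (1 - u).
set N := ~: A :\: B.
have dBN : [disjoint B & N] by rewrite disjoint_sym disjoints_subset subsetDr.
have -> : (t ^+ 2) ^+ (#|B| * #|N|) * rweight z (t ^+ 2) (q / t) B N =
    \prod_(k in B) \prod_(l in N) (f k l * g l k).
  rewrite /rweight mulnC exprM -prodr_const -big_split; apply: eq_bigr => k kB /=.
  rewrite -prodr_const -big_split; apply: eq_bigr => l lN /=.
  have kl : z k != z l.
    by apply: contraTneq kB => /zI->; rewrite (disjointFl dBN).
  have x1 : z k - z l != 0 by rewrite subr_eq0.
  have x2 : z k - t * q * z l != 0 by rewrite subr_eq0.
  rewrite /rphi /f /g /=; field.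
  rewrite !z0 x1 x2 q0 t0 /= andbT -opprB oppr_eq0.
  by rewrite (_ : _ - _ = z k - t * q * z l) //; ring.
rewrite -(prod_cross f g dBN) -!big_split; apply: eq_bigr => k _ /=.
rewrite -!big_split; apply: eq_bigr => l lk /=.
have kl : 1 - z k / z l != 0.
  rewrite subr_eq0 eq_sym; apply: contra lk => /eqP/divr1_eq/zI->//.
have hq : h (q * (z k / z l)) = h (z k / z l) * g k l.
  by rewrite /g /= [RHS]mulrA hz mulrAC divff ?mul1r.
have := subsetP BA k; have := subsetP BA l.
rewrite /pair_factor /common_factor /qshift /N !inE.
have E1 : q^-1 * z k / (1 * z l) = z k / z l / q by rewrite mul1r; ring.
have E2 : 1 * z k / (q^-1 * z l) = q * (z k / z l).
  by rewrite mul1r invfM invrK; ring.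
have E3 : q^-1 * z k / (q^-1 * z l) = z k / z l.
  by rewrite invfM invrK mulrACA mulVf ?mul1r.
have E4 : q * (z k / z l / q) = z k / z l by rewrite mulrC divfK.
case: (k \in B); case: (l \in B); case: (k \in A); case: (l \in A) => //= H H';
  rewrite ?E1 ?E2 ?E3 ?E4 ?mul1r ?mulr1 ?hq //;
  do ?[by have := H isT | by have := H' isT].
Qed.

Hypothesis zg2 : forall k l, z k != (t * q) ^+ 2 * z l.

Lemma sum_pair_prod_qshift A b b' : (b + b')%N = #|~: A| ->
  \sum_(B : {set 'I_n} | (B \subset ~: A) && (#|B| == b))
     pair_prod q t h A B (qshift B z) =
  \sum_(B : {set 'I_n} | (B \subset ~: A) && (#|B| == b'))
     pair_prod q t h A B (qshift B z).
Proof.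
move=> bb.
have E c c' : (c + c')%N = #|~: A| ->
  \sum_(B : {set 'I_n} | (B \subset ~: A) && (#|B| == c))
     pair_prod q t h A B (qshift B z) =
  (1 + t) ^+ #|A| * (\prod_k \prod_(l | l != k) common_factor A k l) *
  ((t ^+ 2) ^+ (c * c')) *
   \sum_(B : {set 'I_n} | (B \subset ~: A) && (#|B| == c))
     rweight z (t ^+ 2) (q / t) B (~: A :\: B).
  move=> cc; rewrite mulr_sumr; apply: eq_bigr => B /andP[BA /eqP Bc].
  rewrite pair_prod_qshift // mulrA; congr (_ * (_ ^+ _) * _).
  by rewrite cardsD (setIidPr BA) Bc -cc addKn.
have ga : t ^+ 2 * (q / t) = t * q by field.
rewrite (E b b') // (E b' b) 1?addnC // (mulnC b'); congr (_ * _).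
apply: ruijsenaars_card => //; rewrite ?mulf_neq0 ?expf_neq0 ?invr_neq0 //.
by split=> [k l _ _|k _|k l _ _|k l _ _] //; rewrite ?ga //; exact: zI.
Qed.

End ShiftedPairProducts.

(** * The density *)

Section PairQuotient.
Variables (R : realType) (q t : R[i]).
Local Notation C := R[i].
Hypotheses (q1 : normc q < 1) (t1 : normc t < 1) (q0 : q != 0) (t0 : t != 0).

Definition qquot (u : C) : C := qpoch u q / qpoch (t ^+ 2 * u) q.

Lemma normc_t2_lt1 : normc (t ^+ 2) < 1.
Proof. by rewrite normcX exprn_ilt1 ?normc_ge0. Qed.

Lemma normc_t2_mul u : normc u <= 1 -> normc (t ^+ 2 * u) <= normc (t ^+ 2).
Proof. by move=> u1; rewrite normcM ler_piMr ?normc_ge0. Qed.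

Lemma qquot1 : qquot 1 = 0.
Proof. by rewrite /qquot qpoch1 // mul0r. Qed.

Lemma qquotS u : normc u <= 1 ->
  qquot u * (1 - t ^+ 2 * u) = (1 - u) * qquot (q * u).
Proof.
move=> u1; rewrite /qquot (qpochS q1 u) (qpochS q1 (t ^+ 2 * u)).
have n1 : 1 - t ^+ 2 * u != 0.
  rewrite subr_eq0; apply/eqP => E; have := normc_t2_mul u1.
  by rewrite -E normc1 leNgt normc_t2_lt1.
rewrite [q * (t ^+ 2 * u)]mulrCA; set a := 1 - t ^+ 2 * u in n1 *.
set D := qpoch (_ * (q * u)) q; rewrite invfM -!mulrA; congr (_ * (_ * _)).
by rewrite [_ * a]mulrC mulKf.
Qed.

Lemma approx_qquot n (S : n.-tuple C -> Prop) v : lbounded S -> approx S v ->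
  (forall z, S z -> normc (v z) <= 1) -> approx S (fun z => qquot (v z)).
Proof.
move=> bS av v1; apply: approxM => //; first exact: (approx_qpoch q1 bS av v1).
apply: (approx_qpochV q1 bS _ normc_t2_lt1) => [|z Sz].
  by apply: approxM => //; exact: approx_cst.
by apply: normc_t2_mul; exact: v1.
Qed.

Lemma torus_densityE n (z : n.-tuple C) :
  torus_density q t z =
  \prod_k \prod_(l | l != k) qquot (tnth z k / tnth z l).
Proof.
rewrite -(prod_lt_offdiag (fun k l => qquot (tnth z k / tnth z l))).
apply: eq_bigr => i _; apply: eq_bigr => j _.
by rewrite /qpoch_pm /qquot !mul1r invf_div invfM mulrACA.
Qed.

Definition qshift_tuple n (B : {set 'I_n}) : n.-tuple C :=
  [tuple if i \in B then q^-1 else 1 | i < n].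

Lemma qshift_tuple_neq0 n (B : {set 'I_n}) i : tnth (qshift_tuple B) i != 0.
Proof. by rewrite tnth_mktuple; case: ifP; rewrite ?invr_neq0 ?oner_neq0. Qed.

Section ApproxPairProd.
Variables (n : nat) (A B : {set 'I_n}).
Let S := two_tori (qshift_tuple B).
Let bS : lbounded S.
Proof. by apply: lbounded_torus_scale => i; exact: qshift_tuple_neq0. Qed.

(** On the rescaled torus |z_k / z_l| is 1, |q| or |q|^-1, the last only for k in B and l outside.
    In that case [pair_factor] involves h(qu) rather than h(u), or has l in B: so every h is
    evaluated inside the closed unit disc on both tori, and no pole is met. *)
Let ratio_bound k l z : S z ->
  [/\ (k \in B) ==> (l \in B) -> normc (tnth z k / tnth z l) <= 1,
      (l \in B) ==> (k \in B) -> normc (tnth z k / tnth z l)^-1 <= 1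
    & normc (q * (tnth z k / tnth z l)) <= 1].
Proof.
pose c : C := if k \in B then (if l \in B then 1 else q^-1)
              else (if l \in B then q else 1).
case=> [tz|[z' tz ->]].
  have nu : normc (tnth z k / tnth z l) = 1 by rewrite normcM normcV !tz divr1.
  by split=> [_|_|]; rewrite ?normcV ?[normc (q * _)]normcM nu ?invr1 ?mulr1 // ltW.
have nu : normc (tnth (tscale (qshift_tuple B) z') k /
                 tnth (tscale (qshift_tuple B) z') l) = normc c.
  rewrite (_ : _ / _ = c * (tnth z' k / tnth z' l)); last first.
    rewrite !tnth_mktuple /c invfM mulrACA; congr (_ * _).
    by case: (k \in B); case: (l \in B); rewrite ?invrK ?mulVf ?invr1 ?mulr1 ?mul1r.
  by rewrite normcM [normc (_ / _)]normcM normcV !tz divr1 mulr1.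
rewrite [normc (q * _)]normcM [normc (_ ^-1)]normcV nu -!normcV -normcM /c.
have qq : normc (q * q) <= 1 by rewrite normcM mulr_ile1 ?normc_ge0 // ltW.
case: (k \in B); case: (l \in B); split; try move=> hyp;
  by rewrite ?invrK ?(mulfV q0) ?invr1 ?mulr1 ?normc1 ?(ltW q1) //.
Qed.

Let approx_ratio k l : approx S (fun z => tnth z k / tnth z l).
Proof.
apply: (@approx_ext _ _ _ (fun z => tnth z k ^ (1 : int) * tnth z l ^ (-1 : int))).
  by move=> z _; rewrite expr1z exprN1.
by apply: approxM => //; exact: approx_coord.
Qed.

Let approx_scaled_ratio c k l : approx S (fun z => c * (tnth z k / tnth z l)).
Proof. by apply: approxM => //; exact: approx_cst. Qed.

Let approx_pair_factor k l : B \subset ~: A ->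
  approx S (fun z => pair_factor q t qquot A B k l (tnth z k / tnth z l)).
Proof.
move=> BA; rewrite /pair_factor.
have approx_lin : approx S (fun z => t * (1 - t * (tnth z k / tnth z l))).
  apply: approxM; [by []|exact: approx_cst|].
  apply: approxB; [by []|exact: approx_cst|exact: approx_scaled_ratio].
have apq : approx S (fun z => qquot (q * (tnth z k / tnth z l))).
  by apply: approx_qquot => // z /(ratio_bound k l)[].
have ap1 : (k \in B) ==> (l \in B) -> approx S (fun z => qquot (tnth z k / tnth z l)).
  by move=> kl; apply: approx_qquot => // z /(ratio_bound k l)[/(_ kl)].
have := subsetP BA k; have := subsetP BA l; rewrite !inE.
case kB: (k \in B); case lB: (l \in B); case kA: (k \in A); case lA: (l \in A) => //= H H';
  do ?[by have := H isT | by have := H' isT];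
  do ?[by apply: ap1; rewrite kB lB]; try exact: apq.
- apply: approxM => //.
  (* Here k is in B, so u may be large but 1/u is bounded by 1: the denominator is expanded as 1 /
     (t - u) = - u^-1 / (1 - t u^-1). *)
  apply: (@approx_ext _ _ _ (fun z => t * (1 - t * (tnth z k / tnth z l)) *
      (- (tnth z k / tnth z l)^-1 * (1 - t * (tnth z k / tnth z l)^-1)^-1))).
    move=> z Sz; have z0 := bS.1 z Sz; congr (_ * _); set u := tnth z k / tnth z l.
    have u0 : u != 0 by rewrite mulf_neq0 ?invr_neq0 ?z0.
    rewrite mulNr -invfM mulrBr mulr1 mulrCA divff // mulr1.
    by rewrite -invrN opprB.
  have apV : approx S (fun z => (tnth z k / tnth z l)^-1).
    by apply: approx_ext (approx_ratio l k) => z _; rewrite invf_div.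
  apply: approxM => //.
  apply: approxM => //.
    apply: (@approx_ext _ _ _ (fun z => -1 * (tnth z k / tnth z l)^-1)).
      by move=> z _; rewrite mulN1r.
    by apply: approxM => //; exact: approx_cst.
  apply: (approx_geometric _ _ t1) => // [|z Sz].
    by apply: approxM => //; exact: approx_cst.
  rewrite normcM ler_piMr ?normc_ge0 //.
  by have [_ /(_ _)-> //] := ratio_bound k l Sz; rewrite kB implybT.
(* Here k and l are in A, so |u| <= 1 and 1 / (1 - t u) is a geometric series. *)
- apply: approxM; [by []|by apply: ap1; rewrite kB|].
  apply: approxM => //.
    apply: approxB; [by []|exact: approx_cst|exact: approx_scaled_ratio].
  apply: (approx_geometric _ _ t1) => // z Sz.
  rewrite normcM ler_piMr ?normc_ge0 //.
  by have [/(_ _)-> //] := ratio_bound k l Sz; rewrite kB.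
Qed.

Lemma approx_pair_prod : B \subset ~: A ->
  approx S (fun z => pair_prod q t qquot A B (tnth z)).
Proof.
move=> BA; apply: approxM => //; first exact: approx_cst.
by apply: approx_prod => // k _; apply: approx_prod => // l _; exact: approx_pair_factor.
Qed.

End ApproxPairProd.
End PairQuotient.

(** * Vanishing *)

Lemma bin2D k r : 'C(k + r, 2) = ('C(k, 2) + 'C(r, 2) + k * r)%N.
Proof.
elim: r => [|r IH]; first by rewrite addn0 muln0 !addn0.
by rewrite addnS !binS !bin1 IH; lia.
Qed.

Lemma bin2_double r : ('C(r, 2) + 'C(r, 2))%N = (r * r.-1)%N.
Proof.
elim: r => // r IH; rewrite binS bin1 addnACA IH; case: r {IH} => // r /=; lia.
Qed.

Section Vanishing.
Variables (R : realType) (n : nat) (q t s : R[i]) (m : int) (P : mpoly (2 * n) R[i]).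
Variable ev : nat -> R[i].
Local Notation C := R[i].
Hypotheses (q1 : normc q < 1) (t1 : normc t < 1) (q0 : q != 0) (t0 : t != 0).
Hypothesis hs : s ^+ 2 = t.
Hypothesis hP : forall (r : nat) (x : 'I_(2 * n) -> C), injective x ->
  macdonald_op q t r (fun y => meval y P) x = ev r * meval x P.
Implicit Types (A B : {set 'I_n}) (z : n.-tuple C).

Let h := qquot q t.

Let s0 : s != 0.
Proof. by apply: contraNneq t0 => s0; rewrite -hs s0 expr0n. Qed.

Let t_neq1 : t != 1.
Proof. by apply: contraTneq t1 => ->; rewrite normc1 ltxx. Qed.

Let torus_neq0 z i : torus z -> tnth z i != 0.
Proof. by move=> tz; rewrite -normc_eq0 tz oner_eq0. Qed.

Let torus_neqM z k l (c : C) : torus z -> normc c < 1 -> tnth z k != c * tnth z l.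
Proof.
move=> tz c1; apply: contraTneq c1 => /(congr1 (@normc R)).
by rewrite normcM !tz mulr1 => <-; rewrite ltxx.
Qed.

Let torus_ratio z k l : torus z -> normc (tnth z k / tnth z l) <= 1.
Proof. by move=> tz; rewrite normcM normcV !tz divr1. Qed.

Let normc_tq : normc (t * q) < 1.
Proof. by rewrite normcM mulr_ilt1 ?normc_ge0. Qed.

Lemma doubled_argsE z i : doubled_args s z i = dbl_arg s (tnth z) i.
Proof. by rewrite /doubled_args /dbl_arg (tnth_nth 0). Qed.

Definition shifted_args A B z (i : 'I_(2 * n)) : C :=
  if i \in dbl_set (A :|: B) B then q * dbl_arg s (tnth z) i else dbl_arg s (tnth z) i.

Lemma macdonald_on_torus r z : torus z ->
  ev r * (meval (doubled_args s z) P * torus_density q t z) =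
  t ^+ 'C(r, 2) * \sum_(p : {set 'I_n} * {set 'I_n} |
      (p.2 \subset ~: p.1) && ((#|p.1| + 2 * #|p.2|)%N == r))
    meval (shifted_args p.1 p.2 z) P * pair_prod q t h p.1 p.2 (tnth z).
Proof.
move=> tz; rewrite torus_densityE -/h.
(* At coinciding coordinates the eigenvalue equation says nothing, but both sides vanish. *)
have [zI|] := boolP (injectiveb (tnth z)); last first.
  case/injectivePn => k [l lk zkl].
  rewrite (prod_offdiag0 (k := k) (l := l)) //; last first.
    by rewrite zkl divff ?torus_neq0 // /h qquot1 // eqxx.
  rewrite !mulr0 big1 ?mulr0 // => p /andP[BA _].
  by rewrite (pair_prod_coincident q t _ lk zkl) ?mulr0 ?torus_neq0 // /h qquot1.
move/injectiveP: zI => zI.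
have xI : injective (doubled_args s z).
  move=> i j; rewrite !doubled_argsE -(dblhK i) -(dblhK j) /dbl_arg !dblK.
  (* Equality would give z_l = t z_k, impossible on the torus as |t| < 1. *)
  have neq k l : s * tnth z k <> s^-1 * tnth z l.
    move/(congr1 ( *%R s)); rewrite mulVKf // mulrA -expr2 hs => /esym/eqP.
    exact/negP/torus_neqM.
  case: (odd i); case: (odd j).
  - by move/(mulfI (invr_neq0 s0))/zI->.
  - by move/esym/neq.
  - by move/neq.
  - by move/(mulfI s0)/zI->.
rewrite mulrA -hP // /macdonald_op -!mulrA; congr (_ * _).
rewrite mulr_suml (eq_bigr (fun I => dbl_coef t s (tnth z) I *
   (meval (fun i => if i \in I then q * doubled_args s z i else doubled_args s z i) P *
    \prod_k \prod_(l | l != k) h (tnth z k / tnth z l)))); last first.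
  move=> I _; rewrite -mulrA; congr (_ * _); apply: eq_bigr => i _; apply: eq_bigr => j _.
  by rewrite !doubled_argsE.
rewrite sum_dbl_set; last first.
  move=> U W UW; rewrite dbl_coef_eq0 ?mul0r // => k; exact: torus_neq0.
apply: eq_bigr => -[A B] /= /andP[BA _].
rewrite mulrCA (@dbl_coefE _ _ q) //.
- by congr (_ * _); apply: meval_eq => i; rewrite /shifted_args doubled_argsE.
- by move=> k; exact: torus_neq0.
- by move=> k l; exact: torus_neqM.
- by move=> k l; apply: qquotS => //; exact: torus_ratio.
Qed.

(** The monomial is the factor (x_1 ... x_(2n))^(lam_(2n)) of P_lam, with m = 2 lam_(2n). The
    operators act on the polynomial P only, so it stays unshifted here and produces powers of q
    under the later substitution. *)
Definition torus_term A B z : C :=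
  (\prod_(i < n) tnth z i) ^ m *
  (meval (shifted_args A B z) P * pair_prod q t h A B (tnth z)).

Lemma approx_meval (S : n.-tuple C -> Prop) (x : n.-tuple C -> 'I_(2 * n) -> C) :
  lbounded S -> (forall i, approx S (fun z => x z i)) ->
  approx S (fun z => meval (x z) P).
Proof.
move=> bS ax; apply: (@approx_ext _ _ _ (fun z =>
   \sum_(e <- msupp P) mcoeff e P * \prod_i x z i ^+ e i)).
  by move=> z _; rewrite mevalE.
apply: approx_sum => e _; apply: approxM => //; first exact: approx_cst.
by apply: approx_prod => // i _; exact: approxX.
Qed.

Lemma approx_prodXz (S : n.-tuple C -> Prop) : lbounded S ->
  approx S (fun z => (\prod_(i < n) tnth z i) ^ m).
Proof.
move=> bS; apply: (@approx_ext _ _ _ (fun z => \prod_(i < n) tnth z i ^ m)).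
  move=> z _; elim/big_rec2: _ => [|i x y _ ->]; first by rewrite exp1rz.
  by rewrite expfzMl.
by apply: approx_prod => // i _; exact: approx_coord.
Qed.

Lemma approx_dbl_arg (S : n.-tuple C -> Prop) i : lbounded S ->
  approx S (fun z => dbl_arg s (tnth z) i).
Proof.
move=> bS; apply: approxM => //; first exact: approx_cst.
by apply: approx_ext (approx_coord _ _ 1) => z _; rewrite expr1z.
Qed.

Lemma approx_torus_term A B : B \subset ~: A ->
  approx (two_tori (qshift_tuple q B)) (torus_term A B).
Proof.
move=> BA; have bS : lbounded (two_tori (qshift_tuple q B)).
  by apply: lbounded_torus_scale => i; exact: qshift_tuple_neq0.
apply: approxM => //; first exact: approx_prodXz.
apply: approxM => //; last exact: approx_pair_prod.
apply: approx_meval => // i; rewrite /shifted_args; case: (i \in _).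
  by apply: approxM => //; [exact: approx_cst | exact: approx_dbl_arg].
exact: approx_dbl_arg.
Qed.

(** The arguments of P after z_k -> q^-1 z_k for k in B: the full shifts have been undone, and B no
    longer occurs. *)
Definition half_args A z (i : 'I_(2 * n)) : C :=
  if ~~ odd i && (dblh i \in A) then q * dbl_arg s (tnth z) i
  else dbl_arg s (tnth z) i.

Definition half_term A B z : C :=
  (\prod_(i < n) tnth z i) ^ m *
  (meval (half_args A z) P * pair_prod q t h A B (qshift q B (tnth z))).

Lemma torus_term_qshift A B z : B \subset ~: A ->
  torus_term A B (tscale (qshift_tuple q B) z) = (q ^ (- m)) ^+ #|B| * half_term A B z.
Proof.
move=> BA; rewrite /torus_term /half_term mulrA; congr (_ * _).
  under eq_bigr do rewrite !tnth_mktuple.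
  rewrite big_split /= -big_mkcond /= prodr_const expfzMl; congr (_ * _).
  by rewrite !exprnP -(exprz_inv q m); exact: exprzAC.
congr (_ * _).
  apply: meval_eq => i; rewrite /shifted_args /half_args /dbl_arg !tnth_mktuple inE.
  have := subsetP BA (dblh i); rewrite !inE.
  case: (odd i); rewrite ?inE; case: (dblh i \in B); case: (dblh i \in A) => //= H;
    rewrite ?mul1r ?orbF //; do ?[by have := H isT];
    by rewrite mulrCA mulVKf.
congr (_ * _); apply: eq_bigr => k _; apply: eq_bigr => l _.
by rewrite !tnth_mktuple.
Qed.

Definition half_integral A b : C :=
  \sum_(B : {set 'I_n} | (B \subset ~: A) && (#|B| == b))
     torus_integral (half_term A B).

Lemma approx_half_term A B : B \subset ~: A -> approx (@torus R n) (half_term A B).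
Proof.
move=> BA; have := approx_two_tori_scale (approx_torus_term BA).
have k0 : (q ^ (- m)) ^+ #|B| != 0 by rewrite expf_neq0 // expfz_neq0.
move=> H; apply: (@approx_ext _ _ _ (fun z => ((q ^ (- m)) ^+ #|B|)^-1 *
   torus_term A B (tscale (qshift_tuple q B) z))).
  by move=> z _; rewrite torus_term_qshift // mulKf.
by apply: approxM => //; [exact: lbounded_torus | exact: approx_cst].
Qed.

(** Ruijsenaars' identity is applied pointwise under the integral, since the value of P is common to
    all B; at coinciding coordinates all terms vanish. *)
Lemma half_integral_sym A b b' : (b + b')%N = #|~: A| ->
  half_integral A b = half_integral A b'.
Proof.
move=> bb; rewrite /half_integral -!torus_integral_sum; first last.
- by move=> B /andP[BA _]; exact: approx_half_term.
- by move=> B /andP[BA _]; exact: approx_half_term.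
apply: torus_integral_ext => z tz; have factor c : \sum_(B : {set 'I_n} | (B \subset ~: A) && (#|B| == c)) half_term A B z =
    (\prod_(i < n) tnth z i) ^ m * (meval (half_args A z) P *
    \sum_(B : {set 'I_n} | (B \subset ~: A) && (#|B| == c))
       pair_prod q t h A B (qshift q B (tnth z))) by rewrite !mulr_sumr.
rewrite !factor; congr (_ * (_ * _)).
have [zI|] := boolP (injectiveb (tnth z)); last first.
  case/injectivePn => k [l lk zkl].
  by rewrite !big1 // => B /andP[BA _];
    rewrite (pair_prod_qshift_coincident t q0 _ lk zkl) ?torus_neq0 // /h qquot1.
move/injectiveP: zI => zI.
apply: sum_pair_prod_qshift => // [k|k l|k l|k l].
- exact: torus_neq0.
- by apply: torus_neqM => //; exact: normc_tq.
- by apply: qquotS => //; exact: torus_ratio.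
- apply: torus_neqM => //; rewrite normcX exprn_ilt1 ?normc_ge0 //; exact: normc_tq.
Qed.

Definition shifted_sum (r : nat) : C :=
  \sum_(p : {set 'I_n} * {set 'I_n} |
      (p.2 \subset ~: p.1) && ((#|p.1| + 2 * #|p.2|)%N == r))
    torus_integral (torus_term p.1 p.2).

(** The rescaling invariance of the integral makes the substitution for each B separately, with a
    factor q^(-m) per element of B; the terms are then grouped by b = |B|. *)
Lemma shifted_sumE r : shifted_sum r =
  \sum_(A : {set 'I_n}) \sum_(b < #|~: A|.+1 | (#|A| + 2 * b)%N == r)
     (q ^ (- m)) ^+ b * half_integral A b.
Proof.
rewrite /shifted_sum -(pair_big_dep xpredT
  (fun A B => (B \subset ~: A) && ((#|A| + 2 * #|B|)%N == r))
  (fun A B => torus_integral (torus_term A B))) /=.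
apply: eq_bigr => A _; under [RHS]eq_bigr do rewrite mulr_sumr.
rewrite [RHS](exchange_big_dep
  (fun B => (B \subset ~: A) && ((#|A| + 2 * #|B|)%N == r))) /=; last first.
  by move=> b B br /andP[-> /eqP->].
apply: eq_bigr => B /andP[BA Br].
have Bc : (#|B| < #|~: A|.+1)%N by rewrite ltnS subset_leq_card.
rewrite (big_pred1 (Ordinal Bc)) /=; last first.
  move=> b; rewrite /= BA /=; apply/andP/eqP => [[_ /eqP Bb]|->].
    exact/val_inj.
  by rewrite /= Br eqxx.
rewrite -(torus_integral_scale (approx_torus_term BA)).
under torus_integral_ext do rewrite torus_term_qshift //.
by rewrite torus_integralZ //; exact: approx_half_term.
Qed.

Let reflect_index a M N b r : (a + M = N -> b < M.+1 -> r <= 2 * N ->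
  (a + 2 * (M - b) == 2 * N - r) = (a + 2 * b == r))%N.
Proof. by lia. Qed.

Let reflect_exponent a M N b r : (a + M)%N = N -> (b < M.+1)%N -> (r <= 2 * N)%N ->
  (a + 2 * (M - b) = 2 * N - r)%N -> (M - b)%N%:Z = N%:Z - r%:Z + b%:Z.
Proof. by lia. Qed.

(** For |A| + 2b = r, the reflected index b' = n - |A| - b satisfies |A| + 2b' = 2n - r and b' = n -
    r + b; this difference of exponents is the same for all A and b. *)
Lemma shifted_sum_sym r : (r <= 2 * n)%N ->
  shifted_sum (2 * n - r) = (q ^ (- m)) ^ (n%:Z - r%:Z) * shifted_sum r.
Proof.
move=> rn; rewrite !shifted_sumE mulr_sumr; apply: eq_bigr => A _.
have cA : (#|A| + #|~: A|)%N = n by rewrite cardsC card_ord.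
rewrite [LHS](reindex_inj rev_ord_inj) /= mulr_sumr.
have k0 : q ^ (- m) != 0 by rewrite expfz_neq0.
apply: eq_big => [b|b].
  by rewrite subSS; exact: reflect_index cA (ltn_ord b) rn.
rewrite subSS => /eqP Eb; have bA := ltn_ord b.
rewrite (@half_integral_sym _ (#|~: A| - b) b) ?subnK // mulrA; congr (_ * _).
rewrite !exprnP -expfzDr //; congr (_ ^ _).
exact: reflect_exponent cA bA rn Eb.
Qed.

Definition torus_value : C := torus_integral (fun z : n.-tuple C =>
  (\prod_(i < n) tnth z i) ^ m * meval (doubled_args s z) P * torus_density q t z).

Lemma eigen_shifted_sum r : ev r * torus_value = t ^+ 'C(r, 2) * shifted_sum r.
Proof.
have bT := @lbounded_torus R n.
have aD : approx (@torus R n) (torus_density q t).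
  apply: approx_ext (approx_two_tori (approx_pair_prod q1 t1 q0 (sub0set (~: set0)))).
  move=> z tz; rewrite torus_densityE /pair_prod cards0 expr0 mul1r.
  by apply: eq_bigr => k _; apply: eq_bigr => l _; rewrite /pair_factor !inE.
rewrite /torus_value -torus_integralZ; last first.
  apply: approxM => //; apply: approxM => //; first exact: approx_prodXz.
  apply: approx_meval => // i.
  by apply: approx_ext (approx_dbl_arg i bT) => z _; rewrite doubled_argsE.
have aT (p : {set 'I_n} * {set 'I_n}) : p.2 \subset ~: p.1 -> approx (@torus R n) (torus_term p.1 p.2).
  by move=> BA; exact: approx_two_tori (approx_torus_term BA).
rewrite /shifted_sum -torus_integral_sum => [|p /andP[BA _]]; last exact: aT.
rewrite -torus_integralZ; last by apply: approx_sum => p /andP[BA _]; exact: aT.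
apply: torus_integral_ext => z tz.
rewrite -mulrA mulrCA macdonald_on_torus // mulrCA; congr (_ * _).
by rewrite mulr_sumr.
Qed.

Lemma eigen_reflect r : torus_value != 0 -> (r <= 2 * n)%N ->
  ev (2 * n - r) = (q ^ (- m)) ^+ n * t ^+ 'C(2 * n, 2) *
     (q ^ m / t ^+ (2 * n).-1) ^+ r * ev r.
Proof.
move=> L0 rN; have k0 : q ^ (- m) != 0 by rewrite expfz_neq0.
apply: (mulIf L0); rewrite -[RHS]mulrA eigen_shifted_sum eigen_shifted_sum.
rewrite shifted_sum_sym // !mulrA; congr (_ * _).
have -> : (q ^ (- m)) ^ (n%:Z - r%:Z) = (q ^ (- m)) ^+ n * (q ^ m) ^+ r.
  by rewrite expfzDr // !exprnP !exprz_exp mulrNN.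
(* Comparing the prefactors of the two operators: this is the origin of t^C(2n, 2) in K and of
   t^(2n-1) in rho. *)
have bE : ('C(2 * n - r, 2) + (2 * n).-1 * r = 'C(2 * n, 2) + 'C(r, 2))%N.
  by rewrite -{2 3}(subnK rN) bin2D; have := bin2_double r; case: r {rN} => [|r] /=; nia.
have tb0 : t ^+ ((2 * n).-1 * r) != 0 by rewrite expf_neq0.
rewrite expr_div_n -exprM; apply: (mulIf tb0).
rewrite mulrAC -exprD bE exprD; field.
by [].
Qed.

End Vanishing.

(** * From weights to partitions, and the conclusion *)

Section Weights.
Variables (N : nat) (lam : N.-tuple rat).
Hypotheses (N0 : (0 < N)%N) (hlam : is_weight lam).

Let last_lam : exists2 k : 'I_N, val k = N.-1 & tnth lam k = last 0 lam.
Proof.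
have kN : (N.-1 < N)%N by rewrite prednK.
by exists (Ordinal kN); rewrite // (tnth_nth 0) -nth_last size_tuple.
Qed.

Lemma weight_partitionE i :
  (weight_partition lam i)%:R = tnth lam i - last 0 lam.
Proof.
have [_ hint hmono] := hlam; have [k kE kl] := last_lam.
rewrite multinomE tnth_mktuple -kl; apply: truncnK.
rewrite natrEint hint subr_ge0 hmono // kE -ltnS prednK //.
Qed.

Lemma weight_floorE : (Num.floor (2 * last 0 lam))%:~R = 2 * last 0 lam.
Proof. by have [h2 _ _] := hlam; have [k _ <-] := last_lam; exact: floorK. Qed.

End Weights.

Lemma meval_mesym (F : fieldType) (N : nat) (X : 'I_N -> F) r :
  meval X (mesym N F r) = elsym X r.
Proof.
rewrite /mesym raddf_sum; apply: eq_bigr => I _ /=.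
rewrite (big_morph (meval X) (mevalM X) (meval1 X)).
by apply: eq_bigr => i _; rewrite mevalXU.
Qed.

Lemma subz_predn_split (N i j : nat) : (i < N)%N -> (j < N)%N ->
  N.-1%:Z - i%:Z - j%:Z = (N.-1 - i)%N%:Z + (N.-1 - j)%N%:Z - N.-1%:Z.
Proof. by lia. Qed.

Lemma subz_predn_eq0 (N i j : nat) : (i < N)%N -> (j < N)%N ->
  N.-1%:Z - i%:Z - j%:Z = 0 -> (N - i.+1)%N = j.
Proof. by lia. Qed.

Lemma torus_value_neq0 (R : realType) (n : nat) (q t s : R[i]) (m : int)
    (P : mpoly (2 * n) R[i]) (mu : 'I_(2 * n) -> nat) :
  generic q t -> s ^+ 2 = t ->
  (forall (r : nat) (x : 'I_(2 * n) -> R[i]), injective x ->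
    macdonald_op q t r (fun y => meval y P) x =
    elsym (fun i : 'I_(2 * n) => q ^+ mu i * t ^+ ((2 * n).-1 - i)) r * meval x P) ->
  torus_value q t s m P != 0 ->
  forall i, m + (mu i)%:Z + (mu (rev_ord i))%:Z = 0.
Proof.
case=> /andP[q_gt0 q_lt1] /andP[t_gt0 t_lt1] gen hs hev L0 i.
have q0 : q != 0 by rewrite -normr_gt0.
have t0 : t != 0 by rewrite -normr_gt0.
have q1 : normc q < 1 by move: q_lt1; rewrite normrc -(rmorph1 (real_complex R)) ltcR.
have t1 : normc t < 1 by move: t_lt1; rewrite normrc -(rmorph1 (real_complex R)) ltcR.
have K0 : (q ^ (- m)) ^+ n * t ^+ 'C(2 * n, 2) != 0.
  by rewrite mulf_neq0 ?expf_neq0 // expfz_neq0.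
have [j E] := elsym_reflect K0
  (fun r => eigen_reflect q1 t1 q0 t0 hs hev L0) i.
(* The relation rho X_i X_j = 1 written as a monomial in q and t. Genericity kills both exponents:
   that of t forces j to be the reversed index of i, and that of q is then the claim. *)
have : q ^ (m + (mu i)%:Z + (mu j)%:Z) * t ^ ((2 * n).-1%:Z - i%:Z - j%:Z) = 1.
  have -> : t ^ ((2 * n).-1%:Z - i%:Z - j%:Z) =
      t ^+ ((2 * n).-1 - i) * t ^+ ((2 * n).-1 - j) / t ^+ (2 * n).-1.
    rewrite !exprnP invr_expz -!expfzDr //; congr (_ ^ _).
    exact: subz_predn_split.
  by rewrite -E !expfzDr //= -!exprnP; ring.
case/gen => Em Et; rewrite (_ : rev_ord i = j) //.
by apply: val_inj; apply: subz_predn_eq0 Et.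
Qed.

Unset Implicit Arguments.
Theorem theorem4p4 (R : realType) (n : nat) (q t s : R[i])
    (lam : (2 * n).-tuple rat) (P : mpoly (2 * n) R[i])
    (hn : (1 <= n)%N) (hqt : generic q t) (hs : s ^+ 2 = t)
    (hlam : is_weight lam)
    (hP : is_macdonald q t (weight_partition lam) P)
    (hdual : ~ (forall i : 'I_(2 * n), tnth lam i = - tnth lam (rev_ord i))) :
  torus_integral (fun z : n.-tuple R[i] =>
    weight_eval lam P (doubled_args s z) (\prod_(i < n) tnth z i) *
    torus_density q t z) = 0.
Proof.
have N0 : (0 < 2 * n)%N by rewrite muln_gt0.
have [_ _ _ eigen] := hP.
apply/eqP/negPn/negP => L0; apply: hdual => i.
have hev r x : injective x -> macdonald_op q t r (fun y => meval y P) x =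
    elsym (fun i : 'I_(2 * n) => q ^+ weight_partition lam i *
      t ^+ ((2 * n).-1 - i)) r * meval x P.
  by rewrite -meval_mesym; exact: eigen.
(* With m = 2 lam_(2n) and mu_i = lam_i - lam_(2n), the sum m + mu_i + mu_j is lam_i + lam_j. *)
have /(congr1 (fun k : int => k%:~R : rat)) :=
  @torus_value_neq0 R n q t s _ P (weight_partition lam) hqt hs hev L0 i.
rewrite !rmorphD /= -!pmulrn !weight_partitionE // weight_floorE //; lra.
Qed.
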